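(* Let $G$ be a $3$-connected cubic planar graph. Then $G$ is an Apollonian dual if and only if $G$ cannot be strongly embedded on an orientable surface of positive genus (i.e. $G$ has no strong embedding on any orientable surface of positive genus).
   Context: All graphs are undirected, connected, simple and finite. An Apollonian network is a planar graph that can be constructed from the complete graph $K_4$ (embedded on the sphere) by recursively subdividing triangular faces (zero or more times), where subdividing a triangular face $(v_1,v_2,v_3)$ means adding a new vertex $v$ adjacent exactly to $v_1,v_2,v_3$ (placed inside the face, which is thereby replaced by three triangular faces). An Apollonian dual is the dual graph of an Apollonian network. An embedding of $G$ on a surface $S$ (compact connected $2$-manifold without boundary) is an injective continuous map $\beta:G\to S$; all embeddings are cellular, i.e. every component of $S\setminus\beta(G)$ (a cell) is an open disc. A facial walk is the closed walk of $G$ bounding a cell. An embedding is strong if all facial walks are cycles of $G$ (no repeated vertices). *)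

(* Defs.v *)
From mathcomp Require Import all_boot all_fingroup.

Set Implicit Arguments.
Unset Strict Implicit.
Unset Printing Implicit Defensive.

(** Cellular embeddings of a connected finite graph on closed orientable
    surfaces are represented, as usual, by rotation systems
    (Heffter-Edmonds-Ringel): a cyclic order of the darts around each vertex.
    The cells are the orbits of the face-tracing permutation, and the genus of
    the surface is given by Euler's formula. *)

Record sgraph := SGraph {
  vertex :> finType;
  adj : rel vertex;
  adj_sym : symmetric adj;
  adj_irrefl : irreflexive adj }.

Definition edges (G : sgraph) : {set {set G}} :=
  [set [set p.1; p.2] | p : G * G & adj p.1 p.2].

Definition cubic (G : sgraph) : Prop :=
  forall x : G, #|[set y | adj x y]| = 3.

Definition k_connected (k : nat) (G : sgraph) : Prop :=
  k < #|G| /\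
  forall S : {set G}, #|S| < k ->
  forall x y, x \notin S -> y \notin S ->
    connect [rel u v | [&& adj u v, u \notin S & v \notin S]] x y.

(** A dart is an edge with a direction, from [dtail] to [dhead]. *)
Definition dart (G : sgraph) : finType := {p : G * G | adj p.1 p.2}.

Section Darts.
Variable G : sgraph.

Definition dtail (d : dart G) : G := (val d).1.
Definition dhead (d : dart G) : G := (val d).2.

Lemma drev_subproof (d : dart G) : adj (dhead d) (dtail d).
Proof. by rewrite adj_sym; exact: valP d. Qed.

Definition drev (d : dart G) : dart G :=
  exist _ (dhead d, dtail d) (drev_subproof d).

Lemma drevK : involutive drev.
Proof. by move=> d; apply: val_inj; case: d => [[x y] p]. Qed.

Definition drev_perm : {perm dart G} := perm (inv_inj drevK).

Record rotation := Rotation {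
  rot :> {perm dart G};
  rot_tail : forall d, dtail (rot d) = dtail d;
  rot_trans : forall d d', dtail d = dtail d' -> d' \in porbit rot d }.

(** The dart following [d] on its facial walk is the successor, around the head
    of [d], of the reversal of [d]. *)
Definition face_perm (R : rotation) : {perm dart G} := (drev_perm * R)%g.

Lemma face_permE (R : rotation) d : face_perm R d = R (drev d).
Proof. by rewrite permM permE. Qed.

Definition faces (R : rotation) : {set {set dart G}} := porbits (face_perm R).

Definition facial_walk (R : rotation) (d : dart G) : seq G :=
  [seq dtail d' | d' <- fingraph.orbit (face_perm R) d].

Definition strong (R : rotation) : Prop :=
  forall d, ucycle (@adj G) (facial_walk R d) /\ 2 < size (facial_walk R d).

(** Euler's formula |V| - |E| + |F| = 2 - 2g, without subtraction (it computes
    the genus when [G] is connected with at least one edge). *)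
Definition has_genus (R : rotation) (g : nat) : Prop :=
  #|G| + #|faces R| + g.*2 = #|edges G| + 2.

(** [x], [y], [z] are consecutive on some facial walk. *)
Definition face_step (R : rotation) (x y z : G) : Prop :=
  exists d : dart G, [/\ dtail d = x, dhead d = y & dhead (face_perm R d) = z].

Definition triangular_face (R : rotation) (a b c : G) : Prop :=
  [/\ face_step R a b c, face_step R b c a & face_step R c a b].

End Darts.

Definition planar (G : sgraph) : Prop := exists R : rotation G, has_genus R 0.

(** The embedded graph [R'] arises from [R] by placing a new vertex [v]
    in the triangular face [(a, b, c)]; [j None] is [v] and [j (Some x)] is the
    old vertex [x].  The face [(a, b, c)] is replaced by the faces [(a, b, v)],
    [(b, c, v)] and [(c, a, v)]; all other facial walks are unchanged. *)
Record face_subdivision (G G' : sgraph) (R : rotation G) (R' : rotation G')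
    (a b c : G) (j : option G -> G') : Prop := FaceSubdivision {
  fs_face : triangular_face R a b c;
  fs_bij : bijective j;
  fs_adj_old : forall x y, adj (j (Some x)) (j (Some y)) = adj x y;
  fs_adj_new : forall x, adj (j None) (j (Some x)) = (x \in [:: a; b; c]);
  fs_face_ab : triangular_face R' (j (Some a)) (j (Some b)) (j None);
  fs_face_bc : triangular_face R' (j (Some b)) (j (Some c)) (j None);
  fs_face_ca : triangular_face R' (j (Some c)) (j (Some a)) (j None);
  fs_face_old : forall x y z,
    (x, y) \notin [:: (a, b); (b, c); (c, a)] -> face_step R x y z ->
    face_step R' (j (Some x)) (j (Some y)) (j (Some z)) }.

(** Apollonian networks, together with their embedding on the sphere. *)
Inductive apollonian_network : forall G : sgraph, rotation G -> Prop :=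
| apollonian_K4 (G : sgraph) (R : rotation G) :
    #|G| = 4 -> (forall x y : G, adj x y = (x != y)) -> has_genus R 0 ->
    apollonian_network R
| apollonian_subdiv (G G' : sgraph) (R : rotation G) (R' : rotation G')
    (a b c : G) (j : option G -> G') :
    apollonian_network R -> face_subdivision R R' a b c j ->
    apollonian_network R'.

(** [H] is (isomorphic to) the dual of the embedded graph [R].  A pair of
    faces is joined in the dual by one edge for each edge of [N] separating them;
    counting these makes the dual multigraph simple and equal to [H]. *)
Definition is_dual (H N : sgraph) (R : rotation N) : Prop :=
  exists h : H -> {set dart N},
    [/\ injective h, h @: [set: H] = faces R &
        forall x y, #|[set d in h x | drev d \in h y]| = adj x y :> nat].

Definition apollonian_dual (H : sgraph) : Prop :=
  exists (N : sgraph) (R : rotation N), apollonian_network R /\ is_dual H R.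

(* Main.v *)
Require Import Defs.
From mathcomp Require Import all_boot all_fingroup.
From mathcomp Require Import all_algebra zify.

Set Implicit Arguments.
Unset Strict Implicit.
Unset Printing Implicit Defensive.

(** Let [N] be the triangulation of the sphere dual to [G].  A cubic vertex has two
    rotations, so an orientable embedding of [G] amounts to the set [s] of those faces
    of [N] at whose dual vertices the rotation of the spherical embedding is reversed
    ([flip]).  A new facial walk turns around vertices of [N], forwards in faces
    outside [s] and backwards in faces of [s], and it changes to the other end of each
    edge of [N] that separates the two kinds of faces.  The embedding is strong when no
    walk meets a face of [N] twice ([strong_flip]).

    Let [N] be Apollonian and [s] strong.  At a vertex of degree three the three faces
    belong all or none to [s], for otherwise one walk meets one of them twice
    ([degree3_no_exception]).  So [s] comes from a strong set of faces of the network
    without this vertex ([subdivision_step]), and in a complete graph on four vertices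
    the same remark shows that [s] is empty or everything.  Hence the embedding is the
    spherical one or its mirror image ([apollonian_rigid]), of genus 0
    ([apollonian_dual_genus]).

    Conversely let [W] be an even hole in [N], that is, a chordless cycle of even length
    or a union of such cycles without edges between them.  By the Jordan curve theorem
    its edges bound a set [s] of faces.  A walk that meets [W] alternates between the
    two sides of [W] and also between the two colours of its vertices; as adjacent
    vertices of [W] have different colours, the embedding is strong ([even_hole_strong]).  It has fewer faces than the spherical
    one ([even_hole_few_faces]), hence positive genus.  So if no such embedding exists,
    then [N] has no even hole, and neither have the triangulations that arise from it
    by removing vertices of degree three.  But a triangulation with more than four
    vertices and none of degree three has an even hole ([degree3_or_even_hole]).
    Therefore vertices of degree three can be removed until four vertices remain, and
    [N] is Apollonian ([apollonian_of_no_even_hole]).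

    The topology of the sphere enters through one statement of linear algebra over the
    field with two elements ([jordan]): by Euler's formula every even set of edges is
    the boundary of a set of faces.  For the dual map it says that an edge set which
    meets every face evenly is a cut; as [G] is 3-connected, this shows that the dual
    of [G] is a simple graph ([face_rev_notin], [face_pair_unique]). *)

(** * Orbits of permutations *)

Section Orbits.
Variable D : finType.
Implicit Types (s : {perm D}) (x y : D).

Lemma porbit_iterP s x y :
  reflect (exists n, y = iter n s x) (y \in porbit s x).
Proof.
by apply: (iffP (porbitP s x y)) => -[n ->]; exists n; rewrite permX.
Qed.

Lemma porbit_stable s x : s x \in porbit s x.
Proof. by apply/porbit_iterP; exists 1. Qed.

Lemma porbit_trans s x y z :
  y \in porbit s x -> z \in porbit s y -> z \in porbit s x.
Proof. by rewrite -!eq_porbit_mem => /eqP -> /eqP ->. Qed.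

Lemma partition_porbits s : partition (porbits s) [set: D].
Proof.
apply/and3P; split.
- apply/eqP/setP=> x; rewrite inE; apply/bigcupP.
  by exists (porbit s x); rewrite ?porbit_id // imset_f.
- apply/trivIsetP=> _ _ /imsetP[x _ ->] /imsetP[y _ ->] neq_xy.
  apply: contraR neq_xy; case/pred0Pn=> z /andP[/= zx zy].
  by move: zx zy; rewrite -!eq_porbit_mem => /eqP <- /eqP <-.
- apply/negP=> /imsetP[x _ eq0].
  by have := porbit_id s x; rewrite -eq0 inE.
Qed.

Lemma mem_porbits s x : porbit s x \in porbits s.
Proof. exact: imset_f. Qed.

Lemma card_uniform_porbits s k :
  (forall x, #|porbit s x| = k) -> #|D| = #|porbits s| * k.
Proof.
move=> ok; rewrite -cardsT; apply: card_uniform_partition (partition_porbits s).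
by move=> _ /imsetP[x _ ->].
Qed.

Lemma card_porbits_label (T : finType) s (l : D -> T) :
  (forall x y, (y \in porbit s x) = (l x == l y)) ->
  (forall t, exists x, l x = t) -> #|porbits s| = #|T|.
Proof.
move=> lP l_onto.
have -> : porbits s = [set [set x | l x == t] | t in T].
  apply/setP=> A; apply/imsetP/imsetP=> [[x _ ->]|[t _ ->]].
    by exists (l x) => //; apply/setP=> y; rewrite inE lP eq_sym.
  by have [x <-] := l_onto t; exists x => //; apply/setP=> y; rewrite inE lP eq_sym.
rewrite card_imset // => t u eq_tu; have [x lx] := l_onto t.
by move/setP/(_ x): eq_tu; rewrite !inE lx eqxx => /esym/eqP.
Qed.

Lemma fun_porbit (T : Type) s (f : D -> T) :
  (forall x, f (s x) = f x) -> forall x y, y \in porbit s x -> f y = f x.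
Proof. by move=> fs x y /porbit_iterP[n ->]; elim: n => //= n <-. Qed.

Lemma porbit_order3 s :
  (forall x, s (s (s x)) = x) -> (forall x, s x <> x) ->
  forall x, porbit s x = [set x; s x; s (s x)] /\ #|porbit s x| = 3.
Proof.
move=> s3 s1 x.
have -> : porbit s x = [set x; s x; s (s x)].
  apply/eqP; rewrite eqEsubset; apply/andP; split; apply/subsetP=> y.
    case/porbit_iterP=> n ->; elim: n => /= [|n]; rewrite !inE ?eqxx //.
    by case/orP=> [/orP[]|] /eqP ->; rewrite ?s3 eqxx ?orbT.
  rewrite !inE => /orP[/orP[]|] /eqP ->; apply/porbit_iterP;
  by [exists 0|exists 1|exists 2].
split=> //; rewrite setUC cardsU1 cards2 !inE.
case: eqP => [E|_]; first by case: (s1 (s (s x))); rewrite s3.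
case: eqP => [/s1|_] //; case: eqP => // E; by case: (s1 x).
Qed.

Lemma porbit_involution s :
  (forall x, s (s x) = x) -> (forall x, s x <> x) ->
  forall x, porbit s x = [set x; s x] /\ #|porbit s x| = 2.
Proof.
move=> s2 s1 x.
have -> : porbit s x = [set x; s x].
  apply/eqP; rewrite eqEsubset; apply/andP; split; apply/subsetP=> y.
    case/porbit_iterP=> n ->; elim: n => /= [|n]; rewrite !inE ?eqxx //.
    by case/orP=> /eqP ->; rewrite ?s2 eqxx ?orbT.
  rewrite !inE => /orP[] /eqP ->; [exact: porbit_id|exact: porbit_stable].
by split=> //; rewrite cards2; case: eqP => // E; case: (s1 x).
Qed.

End Orbits.

Lemma cards3 (T : finType) (x y z : T) :
  x <> y -> x <> z -> y <> z -> #|[set x; y; z]| = 3.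
Proof.
move=> xy xz yz; rewrite setUC cardsU1 cards2 !inE.
by do ![case: eqP => // ?; subst].
Qed.

Lemma porbit_min_card (D : finType) (s : {perm D}) k :
  (forall x, k <= #|porbit s x|) -> #|D| = #|porbits s| * k ->
  forall x, #|porbit s x| = k.
Proof.
move=> k_le cardD x; have := card_partition (partition_porbits s).
rewrite cardsT cardD -sum_nat_const (bigD1 _ (mem_porbits s x)) /=.
rewrite [RHS](bigD1 _ (mem_porbits s x)) /= => eq_sum.
have rest_le : \sum_(A in porbits s | A != porbit s x) k <=
    \sum_(A in porbits s | A != porbit s x) #|A|.
  by apply: leq_sum => A /andP[/imsetP[y _ ->] _]; apply: k_le.
apply/eqP; rewrite eqn_leq k_le andbT -(leq_add2r (\sum_(A in porbits s | A != porbit s x) #|A|)).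
by rewrite -[X in X <= _]eq_sum leq_add2l.
Qed.

(** * The Jordan curve theorem on the sphere *)

Section Jordan.
Import GRing.Theory.
Local Open Scope ring_scope.

Lemma F2_bool (x : 'F_2) : x = (x != 0)%:R.
Proof. by case: x => -[|[|]] //= lt; apply/val_inj. Qed.

Lemma F2_sum_card (T : finType) (A : {set T}) (c : T -> bool) :
  \sum_(x in A) (c x)%:R = (odd #|[set x in A | c x]|)%:R :> 'F_2.
Proof.
rewrite (eq_bigr (fun x => if c x then 1 else 0)); last by move=> x _; case: (c x).
rewrite -big_mkcondr /= sumr_const (eq_card (B := [set x in A | c x])); last first.
  by move=> x; rewrite !inE.
by rewrite -mulr_natl mulr1 -[LHS]Zp_nat_mod // modn2.
Qed.

Variables (D : finType) (e r : {perm D}).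
Hypotheses (eK : forall d, e (e d) = d) (e_neq : forall d, e d <> d).
Hypothesis D_connected : forall t : D -> bool,
  (forall d, t (e d) = t d) -> (forall d, t (r d) = t d) ->
  forall d d', t d = t d'.
Hypothesis sphere :
  (#|porbits r| + #|porbits (e * r)%g| = #|porbits e| + 2)%N.

Let orbit_mx (s : {perm D}) : 'M['F_2]_(#|porbits s|, #|D|) :=
  \matrix_(i, j) (enum_val j \in (enum_val i : {set D}))%:R.

Let orbit_index (s : {perm D}) d : 'I_#|porbits s| :=
  enum_rank_in (mem_porbits s d) (porbit s d).

Let orbit_indexE s d i : (d \in (enum_val i : {set D})) = (i == orbit_index s d).
Proof.
have := enum_valP i => /imsetP[x _ Ei].
apply/idP/eqP => [|->].
  rewrite Ei -eq_porbit_mem => /eqP Ed; apply/enum_val_inj.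
  by rewrite enum_rankK_in ?mem_porbits // Ei Ed.
by rewrite enum_rankK_in ?mem_porbits // porbit_id.
Qed.

Let orbit_index_surj s i : exists d, orbit_index s d = i.
Proof.
have /imsetP[x _ Ei] := enum_valP i; exists x; apply/esym/eqP.
by rewrite -orbit_indexE Ei porbit_id.
Qed.

Let orbit_index_perm s d : orbit_index s (s d) = orbit_index s d.
Proof.
apply/esym/eqP; rewrite -orbit_indexE.
by rewrite enum_rankK_in ?mem_porbits // porbit_stable.
Qed.

Let mul_orbit_mx s (u : 'rV_#|porbits s|) j :
  (u *m orbit_mx s) 0 j = u 0 (orbit_index s (enum_val j)).
Proof.
rewrite mxE (bigD1 (orbit_index s (enum_val j))) //= mxE orbit_indexE eqxx mulr1.
by rewrite big1 ?addr0 // => i ne; rewrite mxE orbit_indexE (negPf ne) mulr0.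
Qed.

Let connectedF (f : D -> 'F_2) :
  (forall d, f (e d) = f d) -> (forall d, f (r d) = f d) ->
  forall d d', f d = f d'.
Proof.
move=> fe fr d d'; rewrite (F2_bool (f d)) (F2_bool (f d')).
by congr ((nat_of_bool _)%:R); apply: (D_connected (t := fun d => f d != 0)) => x; rewrite ?fe ?fr.
Qed.

Let e_mx : 'M['F_2]_#|D| := \matrix_(i, j) (enum_val i == e (enum_val j))%:R.

Let mul_e_mx (u : 'rV_#|D|) j :
  (u *m e_mx) 0 j = u 0 (enum_rank (e (enum_val j))).
Proof.
rewrite mxE (bigD1 (enum_rank (e (enum_val j)))) //= mxE enum_rankK eqxx mulr1.
rewrite big1 ?addr0 // => i ne; rewrite mxE; case: eqP => [E|]; rewrite ?mulr0 //.
by move: ne; rewrite -E enum_valK eqxx.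
Qed.

Let rank_const m n (X : 'M['F_2]_(m, n)) :
  (forall u : 'rV_m, u *m X = 0 -> forall i j, u 0 i = u 0 j) ->
  (m <= \rank X + 1)%N.
Proof.
move=> uX; rewrite -leq_subLR -mxrank_ker.
suff /mxrankS : (kermx X <= (const_mx 1 : 'rV_m))%MS.
  by move/leq_trans; apply; apply: rank_leq_row.
apply/row_subP=> i; set u := row i _.
have u0 : u *m X = 0 by apply/sub_kermxP/row_sub.
have -> : u = u 0 i *: const_mx 1.
  by apply/rowP=> j; rewrite [RHS]mxE [const_mx _ _ _]mxE mulr1; apply: uX.
exact: scalemx_sub.
Qed.

(** Functions on darts are vectors over the field with two elements.  The rows of
    [Q] are the boundaries of the faces, and the kernel of [M] consists of the edge
    sets which meet every vertex evenly; boundaries are of this kind.  Connectedness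
    gives lower bounds for the two ranks, one less than the number of rows, and
    Euler's formula says that they make the two spaces equal. *)
Lemma jordan (c : D -> bool) :
  (forall d, c (e d) = c d) ->
  (forall d, ~~ odd #|[set d' in porbit r d | c d']|) ->
  exists s : D -> bool,
    (forall d, s (r (e d)) = s d) /\ (forall d, c d = s d (+) s (e d)).
Proof.
move=> ce c_even; set f := (e * r)%g; set n := #|D|.
have fE d : f d = r (e d) by rewrite permM.
have nE : n = (#|porbits e| * 2)%N.
  by apply: card_uniform_porbits => d; case: (porbit_involution eK e_neq d).
have add2 (x : 'F_2) : x + x = 0 by case: x => -[|[|]] //= lt; apply/val_inj.
have addeq (x y : 'F_2) : x + y = 0 -> x = y.
  by move=> xy0; rewrite -[x]addr0 -(add2 y) addrA xy0 add0r.
pose Q := orbit_mx f + orbit_mx f *m e_mx.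
have mulQ (u : 'rV_#|porbits f|) j : (u *m Q) 0 j =
    u 0 (orbit_index f (enum_val j)) + u 0 (orbit_index f (e (enum_val j))).
  by rewrite mulmxDr mxE mul_orbit_mx mulmxA mul_e_mx mul_orbit_mx enum_rankK.
have rankQ : (#|porbits f| <= \rank Q + 1)%N.
  apply: rank_const => u /rowP uQ0 i j.
  have [[x <-] [y <-]] := (orbit_index_surj i, orbit_index_surj j).
  have ue d : u 0 (orbit_index f (e d)) = u 0 (orbit_index f d).
    by have := uQ0 (enum_rank d); rewrite mulQ enum_rankK mxE addrC => /addeq.
  apply: (connectedF (f := fun d => u 0 (orbit_index f d))) => // d.
  by rewrite -{1}(eK d) -fE orbit_index_perm ue.
pose M := col_mx (orbit_mx e) (orbit_mx r).
have rankM : (#|porbits e| + #|porbits r| <= \rank M + 1)%N.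
  apply: rank_const => u; rewrite -(hsubmxK u) mul_row_col.
  move: (lsubmx u) (rsubmx u) => x y /rowP uM0.
  have xy d : x 0 (orbit_index e d) = y 0 (orbit_index r d).
    have : (x *m orbit_mx e + y *m orbit_mx r) 0 (enum_rank d) = 0.
      by rewrite uM0 mxE.
    by rewrite mxE !mul_orbit_mx enum_rankK => /addeq.
  have y_const d d' : y 0 (orbit_index r d) = y 0 (orbit_index r d').
    apply: (connectedF (f := fun d => y 0 (orbit_index r d))) => a.
      by rewrite -!xy orbit_index_perm.
    by rewrite orbit_index_perm.
  have val_y k : exists d, row_mx x y 0 k = y 0 (orbit_index r d).
    rewrite mxE; case: (split k) => [a|a]; have [d <-] := orbit_index_surj a.
      by exists d; rewrite xy.
    by exists d.
  by move=> i j; have [a ->] := val_y i; have [b ->] := val_y j; apply: y_const.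
have Q_ker : (Q <= kermx M^T)%MS.
  apply/sub_kermxP/matrixP=> i j; rewrite !mxE.
  have Qi d : Q i (enum_rank d) = (i == orbit_index f d)%:R + (i == orbit_index f (e d))%:R.
    have := mulQ (delta_mx 0 i) (enum_rank d).
    by rewrite -rowE mxE enum_rankK => ->; rewrite !mxE /= !(eq_sym i).
  rewrite (reindex_onto (@enum_rank D) (@enum_val D _)) /=; last first.
    by move=> k _; rewrite enum_valK.
  rewrite (eq_bigl xpredT); last by move=> d; rewrite enum_rankK eqxx.
  under eq_bigr => d _ do rewrite Qi.
  (* A dart contributes to the row [i] of [Q] once for its own face and once for
     the face of its reversal.  The two sums over the darts of the orbit [j]
     agree, since [e], if [j] is an edge, or [r], if [j] is a vertex, maps the
     darts of one to those of the other; in characteristic 2 they cancel. *)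
  rewrite (eq_bigr (fun d => (i == orbit_index f d)%:R * (M j (enum_rank d))
      + (i == orbit_index f (e d))%:R * (M j (enum_rank d)))); last first.
    by move=> d _; rewrite mulrDl !mxE.
  rewrite big_split /=.
  have [eq_e | eq_r] : (forall d, M j (enum_rank (e d)) = M j (enum_rank d)) \/
      (forall d, M j (enum_rank (r d)) = M j (enum_rank d)).
    rewrite /M; case: (splitP j) => k Ek.
      left=> d; have -> : j = lshift _ k by apply: val_inj.
      rewrite !col_mxEu !mxE !enum_rankK !orbit_indexE.
      by rewrite orbit_index_perm.
    right=> d; have -> : j = rshift _ k by apply: val_inj.
    rewrite !col_mxEd !mxE !enum_rankK !orbit_indexE.
    by rewrite orbit_index_perm.
  - rewrite [X in _ + X](reindex_inj (@perm_inj _ e)) /=.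
    by under [X in _ + X]eq_bigr => d _ do rewrite eK eq_e; rewrite add2.
  rewrite [X in X + _](reindex_inj (@perm_inj _ r)) /=.
  under [X in X + _]eq_bigr => d _ do
    rewrite eq_r -{1}(eK d) -fE orbit_index_perm.
  by rewrite add2.
have Q_eq : (Q == kermx M^T)%MS.
  rewrite -(geq_leqif (mxrank_leqif_eq Q_ker)) mxrank_ker mxrank_tr -/n.
  have arith (v k f' p q m : nat) : (v + f' = k + 2 -> f' <= q + 1 ->
      k + v <= p + 1 -> m = k * 2 -> m - p <= q)%N by lia.
  exact: arith sphere rankQ rankM nE.
pose cv : 'rV['F_2]_n := \row_j (c (enum_val j))%:R.
have : (cv <= Q)%MS.
  rewrite (eqmxP Q_eq); apply/sub_kermxP/rowP=> j.
  have sum_M s k : \sum_i cv 0 i * (orbit_mx s)^T i k =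
      \sum_(d in (enum_val k : {set D})) (c d)%:R.
    rewrite (reindex_onto (@enum_rank D) (@enum_val D _)) /=; last first.
      by move=> a _; rewrite enum_valK.
    rewrite (eq_bigl xpredT); last by move=> d; rewrite enum_rankK eqxx.
    rewrite [RHS]big_mkcond; apply: eq_bigr => d _.
    by rewrite !mxE enum_rankK; case: ifP => _; rewrite ?mulr1 ?mulr0.
  rewrite tr_col_mx mul_mx_row mxE [RHS]mxE; case: (split j) => k;
    rewrite mxE sum_M; have /imsetP[d _ ->] := enum_valP k; rewrite F2_sum_card.
  - suff -> : odd #|[set x in porbit e d | c x]| = false by [].
    have -> : [set x in porbit e d | c x] = if c d then porbit e d else set0.
      apply/setP=> x; rewrite !inE; case xd: (x \in porbit e d) => /=; last first.
        by case: ifP; rewrite ?xd ?inE.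
      by rewrite (fun_porbit (f := c) ce xd); case: ifP; rewrite ?xd ?inE.
    by case: ifP; rewrite ?cards0 // (porbit_involution eK e_neq d).2.
  by rewrite (negPf (c_even d)).
case/submxP=> w cw; pose s d := w 0 (orbit_index f d) != 0; exists s; split=> d.
  by rewrite /s -fE orbit_index_perm.
have := congr1 (fun x : 'rV_n => x 0 (enum_rank d)) cw.
rewrite /= mulQ mxE !enum_rankK /s.
rewrite {1}[w 0 (orbit_index f d)]F2_bool {1}[w 0 (orbit_index f (e d))]F2_bool.
by case: (c d); case: (_ != 0); case: (_ != 0) => // /eqP.
Qed.

End Jordan.

(** * Darts and embedded graphs *)

Section DartBasics.
Variable G : sgraph.
Implicit Types (d : dart G) (x y : G) (R : rotation G).

Lemma dart_inj d d' : dtail d = dtail d' -> dhead d = dhead d' -> d = d'.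
Proof.
move=> et eh; apply: val_inj.
by move: et eh; rewrite /dtail /dhead; case: (val d) (val d') => [a b] [a' b'] /= -> ->.
Qed.

Lemma dtail_rev d : dtail (drev d) = dhead d. Proof. by []. Qed.
Lemma dhead_rev d : dhead (drev d) = dtail d. Proof. by []. Qed.

Lemma dart_adj d : adj (dtail d) (dhead d). Proof. exact: (valP d). Qed.

Lemma dart_irrefl d : dtail d <> dhead d.
Proof. by move=> E; have := dart_adj d; rewrite E adj_irrefl. Qed.

Arguments dart_irrefl : clear implicits.

Lemma drev_neq d : drev d <> d.
Proof. by move=> E; apply: (dart_irrefl d); rewrite -{1}E. Qed.

Arguments drev_neq : clear implicits.

Lemma dart_of x y : adj x y -> exists2 d, dtail d = x & dhead d = y.
Proof. by move=> xy; exists (exist _ (x, y) xy : dart G). Qed.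

Lemma drev_permE d : drev_perm G d = drev d. Proof. by rewrite permE. Qed.

Lemma rot_face R d : R d = face_perm R (drev d).
Proof. by rewrite face_permE drevK. Qed.

Lemma dtail_face R d : dtail (face_perm R d) = dhead d.
Proof. by rewrite face_permE rot_tail. Qed.

Lemma rot_porbit R d d' : (d' \in porbit R d) = (dtail d == dtail d').
Proof.
apply/idP/eqP => [|/rot_trans //].
by move/(fun_porbit (f := @dtail G) (rot_tail R)) => ->.
Qed.

Lemma rot_iter R d d' : dtail d = dtail d' -> exists n, d' = iter n R d.
Proof. by move=> E; apply/porbit_iterP; rewrite rot_porbit E. Qed.

Lemma porbit_drev d :
  porbit (drev_perm G) d = [set d; drev d] /\ #|porbit (drev_perm G) d| = 2.
Proof.
rewrite -[X in [set d; X]]drev_permE.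
by apply: porbit_involution => x; rewrite !drev_permE ?drevK //; apply: drev_neq.
Qed.

Lemma card_dart_edges : #|dart G| = #|edges G| * 2.
Proof.
pose E d : {set G} := [set dtail d; dhead d].
have EP d d' : E d = E d' -> d' = d \/ d' = drev d.
  move=> eqE; have: dtail d' \in E d by rewrite eqE !inE eqxx.
  have: dhead d' \in E d by rewrite eqE !inE eqxx orbT.
  rewrite !inE; have := dart_irrefl d'.
  case: (eqVneq (dhead d') (dtail d)) => [h _ _|_ h /= /eqP h'].
    case/orP=> /eqP t; last by right; apply: dart_inj.
    by case: (dart_irrefl d'); rewrite t h.
  case/orP=> /eqP t; first by left; apply: dart_inj.
  by case: h; rewrite t h'.
have -> : edges G = E @: [set: dart G].
  apply/setP=> A; apply/imsetP/imsetP=> [[p]|[d _ ->]].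
    by rewrite inE => p_adj ->; exists (exist _ p p_adj : dart G).
  by exists (val d); rewrite ?inE //; apply: dart_adj.
rewrite (card_uniform_porbits (fun d => (porbit_drev d).2)); congr (_ * 2).
have -> : porbits (drev_perm G) = (fun d => [set d; drev d]) @: [set: dart G].
  apply/setP=> A; apply/imsetP/imsetP=> -[d _ ->]; exists d => //;
  by rewrite (porbit_drev d).1.
pose V (A : {set dart G}) : {set G} := \bigcup_(d in A) E d.
have VE d : V [set d; drev d] = E d.
  rewrite /V; apply/setP=> x; apply/bigcupP/idP => [[y]|xd].
    by rewrite inE !in_set1 => /orP[] /eqP -> //; rewrite /E setUC.
  by exists d; rewrite ?set21.
have -> : E @: [set: dart G] =
    V @: ((fun d => [set d; drev d]) @: [set: dart G]).
  by rewrite -imset_comp; apply: eq_imset => d /=; rewrite VE.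
rewrite (card_in_imset (f := V)) // => _ _ /imsetP[d _ ->] /imsetP[d' _ ->].
by rewrite !VE => /EP[] ->; rewrite // drevK setUC.
Qed.

Lemma has_genus_darts R g :
  has_genus R g <-> #|G| * 2 + #|faces R| * 2 + g * 4 = #|dart G| + 4.
Proof.
rewrite card_dart_edges.
suff arith v k m : v + k + g.*2 = m + 2 <-> v * 2 + k * 2 + g * 4 = m * 2 + 4.
  exact: arith.
by lia.
Qed.

Definition connected :=
  forall t : G -> bool, (forall x y, adj x y -> t x = t y) ->
  forall x y, t x = t y.

Lemma connected_darts R (t : dart G -> bool) : connected ->
  (forall d, t (drev d) = t d) -> (forall d, t (R d) = t d) ->
  forall d d', t d = t d'.
Proof.
move=> G_conn te tR; pose u x := [exists d, (dtail d == x) && t d].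
have tu d : t d = u (dtail d).
  apply/idP/existsP => [td|[d' /andP[/eqP Ed' td']]]; first by exists d; rewrite eqxx.
  by rewrite -(fun_porbit tR (x := d) (y := d')) // rot_porbit Ed'.
move=> d d'; rewrite !tu; apply: G_conn => x y /dart_of[a <- <-].
by rewrite -tu -dtail_rev -tu te.
Qed.

Lemma connected_dart x : connected -> 1 < #|G| -> exists d, dtail d = x.
Proof.
move=> G_conn G_gt1; case: (pickP (fun d => dtail d == x)) => [d /eqP|no].
  by exists d.
have ex_y : exists y, y != x.
  apply/existsP; rewrite -negb_forall; apply/negP=> /forallP G_x.
  move: G_gt1; rewrite (cardD1 x) inE add1n ltnS (eq_card0 (A := _)) // => y.
  by rewrite !inE (eqP (G_x y)) eqxx.
have [y ne_yx] := ex_y.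
suff : (x == x) = (y == x) by rewrite (negPf ne_yx) eqxx.
apply: (G_conn (fun z => z == x)) => a b ab.
have [d da db] := dart_of ab; have := no d; have := no (drev d).
by rewrite dtail_rev da db => -> ->.
Qed.

Lemma card_porbits_rot R : (forall x, exists d, dtail d = x) ->
  #|porbits R| = #|G|.
Proof. by apply: card_porbits_label => d d'; apply: rot_porbit. Qed.

Lemma card_porbits_drev : #|porbits (drev_perm G)| = #|edges G|.
Proof.
have := card_uniform_porbits (fun d => (porbit_drev d).2); rewrite card_dart_edges.
by move/eqP; rewrite eqn_mul2r => /eqP.
Qed.

(** The face permutation is the product of the reversal and the rotation, and the
    parity of a permutation is given by the number of its cycles. *)
Lemma rotation_parity R R' : (forall x, exists d, dtail d = x) ->
  odd #|faces R| = odd #|faces R'|.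
Proof.
move=> no_iso.
have odd_faces (Q : rotation G) : odd #|faces Q| =
    odd #|dart G| (+) (odd_perm (drev_perm G) (+) (odd #|dart G| (+) odd #|G|)).
  rewrite -(card_porbits_rot Q no_iso) -/(odd_perm Q) -odd_permM.
  by rewrite /faces /odd_perm addbA addbb.
by rewrite !odd_faces.
Qed.

(** A facial walk of length two would run along an edge and back, hence turn at a
    vertex where the rotation is trivial. *)
Lemma face_orbit_gt2 R d : (forall d', R d' <> d') ->
  let f := face_perm R in [/\ f d <> d, f (f d) <> f d & f (f d) <> d].
Proof.
move=> R_fix f; have f_fix d' : f d' <> d'.
  by move=> E; have := dtail_face R d'; rewrite -/f E => /(dart_irrefl d').
split=> // E; apply: (R_fix (drev d)).
rewrite -face_permE; apply: dart_inj; first by rewrite dtail_face.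
by rewrite dhead_rev -(dtail_face R) -/f E.
Qed.

End DartBasics.

Arguments dart_irrefl {G} d _.
Arguments drev_neq {G} d _.

(** Here [s] is the indicator function of a set of faces, constant along facial
    walks, and [c] that of a set of edges. *)
Lemma jordan_sphere (G : sgraph) (R : rotation G) (c : dart G -> bool) :
  connected G -> 1 < #|G| -> has_genus R 0 ->
  (forall d, c (drev d) = c d) ->
  (forall x, ~~ odd #|[set d | (dtail d == x) && c d]|) ->
  exists s : dart G -> bool, (forall d, s (face_perm R d) = s d) /\
    (forall d, c d = s d (+) s (drev d)).
Proof.
move=> G_conn G_gt1; rewrite /has_genus addn0 => euler ce c_even.
have e_inv d : drev_perm G (drev_perm G d) = d by rewrite !drev_permE drevK.
have e_fix d : drev_perm G d <> d by rewrite drev_permE; apply: drev_neq.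
have [||||s [s_face s_c]] := @jordan _ (drev_perm G) R e_inv e_fix _ _ c.
- move=> t te tR; apply: (connected_darts (R := R)) => // d.
  by rewrite -[in LHS]drev_permE te.
- rewrite card_porbits_rot => [|x]; last exact: connected_dart.
  by rewrite card_porbits_drev -euler.
- by move=> d; rewrite drev_permE.
- move=> d; rewrite (eq_card (B := [set d' | (dtail d' == dtail d) && c d'])) //.
  by move=> d'; rewrite !inE rot_porbit eq_sym.
exists s; split=> d; last by rewrite s_c drev_permE.
by rewrite face_permE -drev_permE.
Qed.

(** * Reversing faces of a triangulation *)

Section Triangular.
Variables (N : sgraph) (R : rotation N).
Local Notation f := (face_perm R).

Definition triangular := forall d, f (f (f d)) = d.

Definition face_invariant (s : dart N -> bool) := forall d, s (f d) = s d.

(** In the dual cubic graph, whose vertices are the faces of [R], the rotation at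
    the faces in [s] is reversed; the facial walks of the new embedding are the
    orbits of [flip_step s]. *)
Definition flip (s : dart N -> bool) d := if s d then f (f d) else f d.
Definition flip_step s d := flip s (drev d).

(** The vertices of the dual graph on a new facial walk are faces of [R], and the
    other two darts in the face of [d] are [f d] and [f (f d)]. *)
Definition strong_flip s := forall n d,
  iter n (flip_step s) d <> f d /\ iter n (flip_step s) d <> f (f d).

Hypothesis f3 : triangular.

Lemma dhead_face2 d : dhead (f (f d)) = dtail d.
Proof. by rewrite -(dtail_face R) f3. Qed.

Lemma face_neq d : f d <> d.
Proof. by move=> E; have := dtail_face R d; rewrite E => /(dart_irrefl d). Qed.

Lemma face2_neq d : f (f d) <> d.
Proof. by move=> E; apply: (face_neq (d := d)); rewrite -{2}(f3 d) E. Qed.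

Lemma porbit_face d : porbit f d = [set d; f d; f (f d)] /\ #|porbit f d| = 3.
Proof. by apply: porbit_order3 => x; [apply: f3 | apply: face_neq]. Qed.

Lemma rot_neq d : R d <> d.
Proof.
rewrite rot_face => E; apply: (dart_irrefl (f d)).
by rewrite dtail_face -(dtail_face R (f d)) -{2}E f3.
Qed.

Lemma card_faces_triangular : #|dart N| = #|faces R| * 3.
Proof. by apply: card_uniform_porbits => d; case: (porbit_face d). Qed.

Lemma flip_inj s : face_invariant s -> injective (flip s).
Proof.
move=> sf d d' E; have ss x : s (flip s x) = s x.
  by rewrite /flip; case: ifP; rewrite !sf.
have sE : s d = s d' by rewrite -ss E ss.
by move: E; rewrite /flip sE; case: ifP => _; do ?move/perm_inj.
Qed.

Lemma flip_step_inj s : face_invariant s -> injective (flip_step s).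
Proof. by move=> sf d d' /(flip_inj sf) /(can_inj (@drevK N)). Qed.

(** At a vertex of degree three, let the face of [y] be the only one of the three
    faces to be reversed, or the only one not to be reversed.  Then the facial walk
    which crosses the other two faces comes from the face of [y] and returns to it
    after three steps, in another of its darts. *)
Lemma degree3_no_exception s y : face_invariant s -> strong_flip s ->
  R (R (R y)) = y -> s (R y) = s (R (R y)) -> s y = s (R y).
Proof.
move=> sf s_strong r3 eq_s.
have rE d : f (drev d) = R d by rewrite face_permE drevK.
have rev_s d : s (drev d) = s (R d) by rewrite -rE sf.
have f2E d : f (f (R d)) = drev d by rewrite -rE f3.
case sy: (s y); case sry: (s (R y)) => //; rewrite sry in eq_s.
- have [] := s_strong 3 y; case.
  have step1 : flip_step s y = R y by rewrite /flip_step /flip rev_s sry rE.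
  have step2 : flip_step s (R y) = R (R y).
    by rewrite /flip_step /flip rev_s -eq_s rE.
  have step3 : flip_step s (R (R y)) = f y.
    by rewrite /flip_step /flip rev_s r3 sy rE r3.
  by rewrite /= step1 step2 step3.
have f2y : f (f y) = drev (R (R y)) by rewrite -{1}r3 f2E.
have [_] := s_strong 3 (f (f y)); case.
have step1 : flip_step s (f (f y)) = drev (R y).
  by rewrite /flip_step f2y drevK /flip -eq_s f2E.
have step2 : flip_step s (drev (R y)) = drev y.
  by rewrite /flip_step drevK /flip sry f2E.
have step3 : flip_step s (drev y) = f y by rewrite /flip_step drevK /flip sy.
by rewrite /= step1 step2 step3 f3.
Qed.

Lemma degree3_faces s y : face_invariant s -> strong_flip s ->
  R (R (R y)) = y -> s (R y) = s y /\ s (R (R y)) = s y.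
Proof.
move=> sf ss r3.
have := degree3_no_exception sf ss r3.
have := degree3_no_exception sf ss (y := R y); rewrite r3 => /(_ erefl).
have := degree3_no_exception sf ss (y := R (R y)); rewrite !r3 => /(_ erefl).
by case: (s y); case: (s (R y)); case: (s (R (R y))) => // h1 h2 h3;
  move: (h1 erefl) || move: (h2 erefl) || move: (h3 erefl).
Qed.

End Triangular.

(** * Strong embeddings of Apollonian duals *)

Section Degree.
Variables (G : sgraph) (R : rotation G).

Lemma card_porbit_rot d : #|porbit R d| = #|[set y | adj (dtail d) y]|.
Proof.
have -> : [set y | adj (dtail d) y] = @dhead G @: porbit R d.
  apply/setP=> y; rewrite inE; apply/idP/imsetP => [/dart_of[d' td <-]|[d' d'd ->]].
    by exists d' => //; rewrite rot_porbit td.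
  by move: d'd; rewrite rot_porbit => /eqP ->; apply: dart_adj.
rewrite card_in_imset // => a b; rewrite !rot_porbit => /eqP ta /eqP tb.
by apply: dart_inj; rewrite -ta -tb.
Qed.

Hypothesis degree3 : forall x : G, #|[set y | adj x y]| = 3.

Lemma degree3_rot d : R (R (R d)) = d.
Proof. by have := iter_porbit R d; rewrite card_porbit_rot degree3. Qed.

Lemma degree3_rot_neq d : R d <> d.
Proof.
move=> E; have := card_porbit_rot d; rewrite degree3.
suff -> : porbit R d = [set d] by rewrite cards1.
apply/setP=> x; rewrite inE; apply/porbit_iterP/eqP => [[n ->]|->]; last by exists 0.
by elim: n => //= n ->.
Qed.

Lemma degree3_dart x : exists d : dart G, dtail d = x.
Proof.
have : [set y | adj x y] != set0 by rewrite -cards_eq0 degree3.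
by case/set0Pn=> y; rewrite inE => /dart_of[d <- _]; exists d.
Qed.

Lemma degree3_card_dart : #|dart G| = #|G| * 3.
Proof.
rewrite -(card_porbits_rot R degree3_dart).
by apply: card_uniform_porbits => d; rewrite card_porbit_rot degree3.
Qed.

End Degree.

Section K4.
Variables (G : sgraph) (R : rotation G).
Hypotheses (G4 : #|G| = 4) (G_complete : forall x y : G, adj x y = (x != y))
  (R_sphere : has_genus R 0).

Lemma K4_degree (x : G) : #|[set y | adj x y]| = 3.
Proof.
rewrite (eq_card (B := predC1 x)); first by rewrite cardC1 G4.
by move=> y; rewrite !inE G_complete eq_sym.
Qed.

Lemma K4_triangular : triangular R.
Proof.
move=> d; have := iter_porbit (face_perm R) d; rewrite (@porbit_min_card _ _ 3) //.
  move=> x; have [ne1 ne2 ne3] := face_orbit_gt2 x (@degree3_rot_neq _ R K4_degree).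
  rewrite -(@cards3 _ x (face_perm R x) (face_perm R (face_perm R x))); try congruence.
  apply: subset_leq_card; apply/subsetP=> y.
  by rewrite !inE => /orP[/orP[]|] /eqP ->; apply/porbit_iterP;
    [exists 0 | exists 1 | exists 2].
have /has_genus_darts := R_sphere.
rewrite (_ : #|porbits (face_perm R)| = #|faces R|) //.
by rewrite (degree3_card_dart R K4_degree) G4; lia.
Qed.

Lemma K4_flip s : face_invariant R s -> strong_flip R s -> forall d d', s d = s d'.
Proof.
move=> sf ss; have s_rot d : s (R d) = s d.
  by have [] := degree3_faces K4_triangular sf ss (@degree3_rot _ R K4_degree d).
have s_rev d : s (drev d) = s d.
  by rewrite -[RHS]s_rot rot_face sf.
have s_tail d d' : dtail d = dtail d' -> s d = s d'.
  by move=> E; apply/esym/(fun_porbit s_rot); rewrite rot_porbit E.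
move=> d d'; case: (eqVneq (dtail d) (dtail d')) => [/s_tail //|].
rewrite -G_complete => /dart_of[a ad ad'].
by rewrite (s_tail d a) // -s_rev; apply: s_tail.
Qed.

End K4.

Lemma triangular_face_darts (G : sgraph) (R : rotation G) a b c :
  triangular_face R a b c -> exists AB BC CA : dart G,
    [/\ dtail AB = a /\ dhead AB = b, dtail BC = b /\ dhead BC = c,
        dtail CA = c /\ dhead CA = a &
        [/\ face_perm R AB = BC, face_perm R BC = CA & face_perm R CA = AB]].
Proof.
case=> [[AB [ab1 ab2 ab3]] [BC [bc1 bc2 bc3]] [CA [ca1 ca2 ca3]]].
exists AB, BC, CA; split=> //.
by split; apply: dart_inj; rewrite ?dtail_face ?ab2 ?bc2 ?ca2.
Qed.

(** Subdivision is undone for [flip]: the three faces at the new vertex agree by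
    [degree3_faces], and the values of [s'] on the old faces still give a strong
    embedding, as its facial walks are cut out of the former ones. *)
Section Subdivision.
Variables (N N' : sgraph) (R : rotation N) (R' : rotation N') (a b c : N).
Variable j : option N -> N'.
Hypothesis sub : face_subdivision R R' a b c j.
Hypothesis f3 : triangular R.
Local Notation f := (face_perm R).
Local Notation f' := (face_perm R').

Let old_subproof (d : dart N) : adj (j (Some (dtail d))) (j (Some (dhead d))).
Proof. by rewrite (fs_adj_old sub) dart_adj. Qed.

Let J (d : dart N) : dart N' := exist _ (_, _) (old_subproof d).

Let J_inj : injective J.
Proof.
have j_inj := bij_inj (fs_bij sub).
by move=> d d' [/j_inj[t] /j_inj[h]]; apply: dart_inj.
Qed.

Let J_rev d : J (drev d) = drev (J d).
Proof. exact: dart_inj. Qed.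

Let J_face d : (dtail d, dhead d) \notin [:: (a, b); (b, c); (c, a)] ->
  f' (J d) = J (f d).
Proof.
move/(fs_face_old sub) => /(_ (dhead (f d))) [|d' [t h fh]].
  by exists d.
rewrite -[J d](_ : d' = _); last exact: dart_inj.
by apply: dart_inj => //; rewrite dtail_face h -(dtail_face R).
Qed.

Lemma subdivision_step :
  [/\ triangular R', #|N'| = #|N| + 1, #|dart N'| = #|dart N| + 6,
   ((forall x : N, exists d, dtail d = x) -> forall x : N', exists d, dtail d = x) &
   ((forall s, face_invariant R s -> strong_flip R s -> forall d d', s d = s d') ->
    forall s', face_invariant R' s' -> strong_flip R' s' ->
    forall d d', s' d = s' d')].
Proof.
have j_inj := bij_inj (fs_bij sub); set v := j None.
have [AB [BC [CA]]] := triangular_face_darts (fs_face sub).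
case=> -[tAB hAB] [tBC hBC] [tCA hCA] [fAB fBC fCA].
have [AB' [BV [VA]]] := triangular_face_darts (fs_face_ab sub).
case=> -[tAB' hAB'] [tBV hBV] [tVA hVA] [fAB' fBV fVA].
have [BC' [CV [VB]]] := triangular_face_darts (fs_face_bc sub).
case=> -[tBC' hBC'] [tCV hCV] [tVB hVB] [fBC' fCV fVB].
have [CA' [AV [VC]]] := triangular_face_darts (fs_face_ca sub).
case=> -[tCA' hCA'] [tAV hAV] [tVC hVC] [fCA' fAV fVC].
have JAB : J AB = AB'.
  by apply: dart_inj; rewrite ?tAB' ?hAB' -?tAB -?hAB.
have JBC : J BC = BC'.
  by apply: dart_inj; rewrite ?tBC' ?hBC' -?tBC -?hBC.
have JCA : J CA = CA'.
  by apply: dart_inj; rewrite ?tCA' ?hCA' -?tCA -?hCA.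
have rVA : drev VA = AV by apply: dart_inj; rewrite ?dtail_rev ?dhead_rev; congruence.
have rVB : drev VB = BV by apply: dart_inj; rewrite ?dtail_rev ?dhead_rev; congruence.
have rVC : drev VC = CV by apply: dart_inj; rewrite ?dtail_rev ?dhead_rev; congruence.
have rAV : drev AV = VA by rewrite -rVA drevK.
have rBV : drev BV = VB by rewrite -rVB drevK.
have rCV : drev CV = VC by rewrite -rVC drevK.
have abcP d : [\/ d = AB, d = BC, d = CA |
    (dtail d, dhead d) \notin [:: (a, b); (b, c); (c, a)]].
  case: (boolP (_ \in _)) => [|_]; last by constructor 4.
  rewrite !inE !xpair_eqE => /or3P[] /andP[/eqP t /eqP h];
  by [constructor 1; apply: dart_inj; congruence
     |constructor 2; apply: dart_inj; congruence
     |constructor 3; apply: dart_inj; congruence].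
have notin_abc d : (dtail d, dhead d) \notin [:: (a, b); (b, c); (c, a)] <->
    [/\ d <> AB, d <> BC & d <> CA].
  split=> [d_abc|[h1 h2 h3]]; last by case: (abcP d).
  by split=> E; move: d_abc; rewrite E ?tAB ?hAB ?tBC ?hBC ?tCA ?hCA !inE eqxx ?orbT.
have face_abc d : (dtail d, dhead d) \notin [:: (a, b); (b, c); (c, a)] ->
    (dtail (f d), dhead (f d)) \notin [:: (a, b); (b, c); (c, a)].
  move/notin_abc=> [h1 h2 h3]; apply/notin_abc; split=> E.
  - by apply: h3; apply: (@perm_inj _ f); rewrite E.
  - by apply: h1; apply: (@perm_inj _ f); rewrite E.
  - by apply: h2; apply: (@perm_inj _ f); rewrite E.
have dartsP d' : (exists d, d' = J d) \/
    (d' \in [set VA; VB; VC]) || (d' \in [set AV; BV; CV]).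
  have [i ij ji] := fs_bij sub.
  case Et: (i (dtail d')) => [x|]; case Eh: (i (dhead d')) => [y|];
    have := dart_adj d'; rewrite -(ji (dtail d')) -(ji (dhead d')) Et Eh.
  - rewrite (fs_adj_old sub) => /dart_of[d dx dy]; left; exists d.
    by apply: dart_inj; rewrite -[LHS]ji ?Et ?Eh -?dx -?dy.
  - rewrite adj_sym (fs_adj_new sub) !inE => x_abc; right.
    have [h t] : dhead d' = v /\ dtail d' = j (Some x) by rewrite /v -Et -Eh !ji.
    case/or3P: x_abc => /eqP Ex.
    + by rewrite (_ : d' = AV) ?eqxx ?orbT //; apply: dart_inj; congruence.
    + by rewrite (_ : d' = BV) ?eqxx ?orbT //; apply: dart_inj; congruence.
    + by rewrite (_ : d' = CV) ?eqxx ?orbT //; apply: dart_inj; congruence.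
  - rewrite (fs_adj_new sub) !inE => x_abc; right.
    have [h t] : dhead d' = j (Some y) /\ dtail d' = v by rewrite /v -Et -Eh !ji.
    case/or3P: x_abc => /eqP Ex.
    + by rewrite (_ : d' = VA) ?eqxx ?orbT //; apply: dart_inj; congruence.
    + by rewrite (_ : d' = VB) ?eqxx ?orbT //; apply: dart_inj; congruence.
    + by rewrite (_ : d' = VC) ?eqxx ?orbT //; apply: dart_inj; congruence.
  - by rewrite adj_irrefl.
have f3' : triangular R'.
  move=> d'; case: (dartsP d') => [[d ->]|].
    case: (abcP d) => [->|->|->|d_abc].
    - by rewrite JAB fAB' fBV fVA.
    - by rewrite JBC fBC' fCV fVB.
    - by rewrite JCA fCA' fAV fVC.
    have abc1 := face_abc _ d_abc; have abc2 := face_abc _ abc1.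
    by rewrite J_face // J_face // J_face // f3.
  rewrite !inE => /orP[] /orP[/orP[]|] /eqP ->;
  by rewrite ?(fVA, fVB, fVC, fAV, fBV, fCV) ?(fAB', fBC', fCA')
             ?(fVA, fVB, fVC, fAV, fBV, fCV).
have ab : a <> b by move=> E; apply: (dart_irrefl AB); congruence.
have bc : b <> c by move=> E; apply: (dart_irrefl BC); congruence.
have ca : c <> a by move=> E; apply: (dart_irrefl CA); congruence.
have jS x y : x <> y -> j (Some x) <> j (Some y) by move=> ? /j_inj[].
have jv x : j (Some x) <> v by move/j_inj.
split=> //.
- by rewrite -(bij_eq_card (fs_bij sub)) card_option addn1.
- rewrite -cardsT -(cardsID (J @: [set: dart N])) setTI card_imset // cardsT.
  congr (_ + _); have -> : [set: dart N'] :\: J @: [set: dart N] =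
      [set VA; VB; VC] :|: [set AV; BV; CV].
    apply/setP=> d'; rewrite in_setD in_setT andbT in_setU.
    case: (dartsP d') => [[d ->]|new].
      rewrite imset_f // !inE; apply/esym/negbTE/negP=> /orP[] /orP[/orP[]|] /eqP E.
      - by apply: (jv (dtail d)); rewrite /v -tVA -E.
      - by apply: (jv (dtail d)); rewrite /v -tVB -E.
      - by apply: (jv (dtail d)); rewrite /v -tVC -E.
      - by apply: (jv (dhead d)); rewrite /v -hAV -E.
      - by apply: (jv (dhead d)); rewrite /v -hBV -E.
      - by apply: (jv (dhead d)); rewrite /v -hCV -E.
    rewrite new; apply/negP=> /imsetP[d _ E]; move: new; rewrite E.
    rewrite !inE => /orP[] /orP[/orP[]|] /eqP E'.
    - by apply: (jv (dtail d)); rewrite /v -tVA -E'.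
    - by apply: (jv (dtail d)); rewrite /v -tVB -E'.
    - by apply: (jv (dtail d)); rewrite /v -tVC -E'.
    - by apply: (jv (dhead d)); rewrite /v -hAV -E'.
    - by apply: (jv (dhead d)); rewrite /v -hBV -E'.
    - by apply: (jv (dhead d)); rewrite /v -hCV -E'.
  have neq (x y : dart N') : dtail x <> dtail y \/ dhead x <> dhead y -> x <> y.
    by move=> h E; case: h; rewrite E.
  rewrite cardsU !cards3; try (by apply: neq; rewrite ?(tVA, tVB, tVC, hVA, hVB, hVC,
    tAV, tBV, tCV); ((left; by apply: jS; congruence) || (right; by apply: jS; congruence))).
  rewrite (_ : _ :&: _ = set0) ?cards0 //; apply/setP=> d'; rewrite in_setI in_set0.
  apply/negbTE/negP=> /andP[]; rewrite !inE => h1 h2.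
  have t : dtail d' = v by case/orP: h1 => [/orP[]|] /eqP ->.
  by case/orP: h2 => [/orP[]|] /eqP E; apply: jv; rewrite -t E ?tAV ?tBV ?tCV.
- move=> no_iso x; have [i _ ji] := fs_bij sub.
  case Ex: (i x) => [y|]; last by exists VA; rewrite tVA -Ex ji.
  by have [d dy] := no_iso y; exists (J d); rewrite -[RHS]ji Ex -dy.
move=> IH s' sf' ss'.
have RVA : R' VA = VC by rewrite rot_face rVA.
have RVC : R' VC = VB by rewrite rot_face rVC.
have RVB : R' VB = VA by rewrite rot_face rVB.
have rot3 : R' (R' (R' VA)) = VA by rewrite RVA RVC RVB.
have [sVC sVB] := degree3_faces f3' sf' ss' rot3.
move: sVC sVB; rewrite RVA RVC => sVC sVB.
(* The three faces at the new vertex have one value, which becomes the value of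
   the old face. *)
have sAB : s' AB' = s' VA by rewrite -fVA sf'.
have sBC : s' BC' = s' VA by rewrite -fVB sf' sVB.
have sCA : s' CA' = s' VA by rewrite -fVC sf' sVC.
have sBV : s' BV = s' VA by rewrite -fBV sf'.
have sCV : s' CV = s' VA by rewrite -sVB -fCV sf'.
have sAV : s' AV = s' VA by rewrite -sVC -fAV sf'.
pose s d := s' (J d).
have sf : face_invariant R s.
  move=> d; rewrite /s; case: (abcP d) => [->|->|->|d_abc].
  - by rewrite fAB JBC JAB sBC sAB.
  - by rewrite fBC JCA JBC sCA sBC.
  - by rewrite fCA JAB JCA sCA sAB.
  by rewrite -J_face // sf'.
pose p' := flip_step R' s'.
have p'_inj : injective p' by apply: flip_step_inj.
have p'J d : p' (J d) = flip R' s' (J (drev d)) by rewrite J_rev.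
(* The old darts on a new facial walk form a facial walk for [s]: a new walk makes
   at most one step on the three new edges before it returns. *)
have first_return d : exists m, J (flip_step R s d) = iter m p' (J d).
  case: (abcP (drev d)) => [E|E|E|d_abc].
  - exists 2; rewrite /= p'J /p' /flip_step E /flip /s JAB sAB; case Et: (s' VA).
      by rewrite fAB fBC JCA fAB' fBV rVA sAV Et fAV fVC.
    by rewrite fAB JBC fAB' rBV sVB Et fVB.
  - exists 2; rewrite /= p'J /p' /flip_step E /flip /s JBC sBC; case Et: (s' VA).
      by rewrite fBC fCA JAB fBC' fCV rVB sBV Et fBV fVA.
    by rewrite fBC JCA fBC' rCV sVC Et fVC.
  - exists 2; rewrite /= p'J /p' /flip_step E /flip /s JCA sCA; case Et: (s' VA).
      by rewrite fCA fAB JBC fCA' fAV rVC sCV Et fCV fVB.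
    by rewrite fCA JAB fCA' rAV Et fVA.
  exists 1; rewrite /= p'J /flip_step /flip /s; case: (s' _); last by rewrite J_face.
  by rewrite [in RHS]J_face // [in RHS]J_face //; apply: face_abc.
have iter_return n d : exists m, J (iter n (flip_step R s) d) = iter m p' (J d).
  elim: n => [|n [m Em]]; first by exists 0.
  have [k Ek] := first_return (iter n (flip_step R s) d).
  by exists (k + m); rewrite /= Ek Em iterD.
have no_path_in X Y P : p' P = Y -> X <> Y -> P = f' X \/ P = f' (f' X) ->
    forall m, iter m p' X <> Y.
  move=> PY XY PX [|m] //=; rewrite -PY => /p'_inj E.
  by have [h1 h2] := ss' m X; case: PX => EP; [apply: h1 | apply: h2]; rewrite -EP.
have no_path_out X Y P : p' P = X -> Y = f' P \/ Y = f' (f' P) ->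
    forall m, iter m p' X <> Y.
  move=> <- PY m; rewrite -iterSr => E.
  by have [h1 h2] := ss' m.+1 P; case: PY => EP; [apply: h1 | apply: h2]; rewrite -EP.
have [ABC' BCA' CAB'] : [/\ AB' <> BC', BC' <> CA' & CA' <> AB'].
  by rewrite -JAB -JBC -JCA; split=> /J_inj E;
    [apply: ab | apply: bc | apply: ca]; congruence.
have no_path_abc m : [/\ iter m p' AB' <> BC', iter m p' BC' <> CA',
    iter m p' CA' <> AB' & [/\ iter m p' AB' <> CA', iter m p' BC' <> AB' &
    iter m p' CA' <> BC']].
  case Et: (s' VA).
    have pVA : p' VA = CA' by rewrite /p' /flip_step /flip rVA sAV Et fAV fVC.
    have pVB : p' VB = AB' by rewrite /p' /flip_step /flip rVB sBV Et fBV fVA.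
    have pVC : p' VC = BC' by rewrite /p' /flip_step /flip rVC sCV Et fCV fVB.
    split; last split.
    - by apply: (no_path_out _ _ VB) => //; left.
    - by apply: (no_path_out _ _ VC) => //; left.
    - by apply: (no_path_out _ _ VA) => //; left.
    - by apply: (no_path_in _ _ VA) => //; [congruence | right; rewrite fAB' fBV].
    - by apply: (no_path_in _ _ VB) => //; [congruence | right; rewrite fBC' fCV].
    - by apply: (no_path_in _ _ VC) => //; [congruence | right; rewrite fCA' fAV].
  have pAV : p' AV = AB' by rewrite /p' /flip_step /flip rAV Et fVA.
  have pBV : p' BV = BC' by rewrite /p' /flip_step /flip rBV sVB Et fVB.
  have pCV : p' CV = CA' by rewrite /p' /flip_step /flip rCV sVC Et fVC.
  split; last split.
  - by apply: (no_path_in _ _ BV) => //; left.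
  - by apply: (no_path_in _ _ CV) => //; left.
  - by apply: (no_path_in _ _ AV) => //; left.
  - by apply: (no_path_out _ _ AV) => //; right; rewrite fAV fVC.
  - by apply: (no_path_out _ _ BV) => //; right; rewrite fBV fVA.
  - by apply: (no_path_out _ _ CV) => //; right; rewrite fCV fVB.
have ss : strong_flip R s.
  move=> n d; have [m Em] := iter_return n d.
  have [n1 n2 n3 [n4 n5 n6]] := no_path_abc m.
  suff [h1 h2] : iter m p' (J d) <> J (f d) /\ iter m p' (J d) <> J (f (f d)).
    by split=> E; [apply: h1 | apply: h2]; rewrite -Em E.
  case: (abcP d) => [->|->|->|d_abc].
  - by rewrite fAB fBC JAB JBC JCA.
  - by rewrite fBC fCA JAB JBC JCA.
  - by rewrite fCA fAB JAB JBC JCA.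
  rewrite -(J_face (face_abc _ d_abc)) -(J_face d_abc); exact: ss'.
have s_const := IH s sf ss.
have all_VA d' : s' d' = s' VA.
  case: (dartsP d') => [[d ->]|]; first by rewrite -/(s d) (s_const d AB) /s JAB.
  by rewrite !inE => /orP[] /orP[/orP[]|] /eqP ->.
by move=> d d'; rewrite !all_VA.
Qed.

End Subdivision.

(** Hence the strong orientable embeddings of an Apollonian dual are the spherical
    one and its mirror image. *)
Lemma apollonian_rigid (N : sgraph) (R : rotation N) : apollonian_network R ->
  [/\ triangular R, #|dart N| + 12 = #|N| * 6, (forall x : N, exists d, dtail d = x) &
     forall s, face_invariant R s -> strong_flip R s -> forall d d', s d = s d'].
Proof.
elim=> {N R} [N R N4 N_complete N_sphere | N N' R R' a b c j _ [f3 cardN no_iso IH] sub].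
  have N_degree := K4_degree N4 N_complete.
  split; [exact: K4_triangular | | exact: degree3_dart | exact: K4_flip].
  by rewrite (degree3_card_dart R N_degree) N4.
have [f3' cardN' card_dart' iso' step] := subdivision_step sub f3.
split=> //; [ | exact: iso' | exact: step IH].
by rewrite card_dart' cardN'; move: cardN; lia.
Qed.

(** * Darts of the dual *)

Lemma uniq_map_inj (T U : eqType) (h : T -> U) (s : seq T) :
  uniq (map h s) -> {in s &, injective h}.
Proof.
elim: s => //= z s IH /andP[hz us] x y; rewrite !inE.
case/predU1P=> [->|xs] /predU1P[->|ys] //= E; last exact: IH.
  by case/negP: hz; rewrite E map_f.
by case/negP: hz; rewrite -E map_f.
Qed.

Lemma strongP (G : sgraph) (Q : rotation G) : (forall x, Q x <> x) ->
  strong Q <->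
  forall n x, dtail (iter n (face_perm Q) x) = dtail x -> iter n (face_perm Q) x = x.
Proof.
move=> Q_fix; set F := face_perm Q; have F_inj : injective F by apply: perm_inj.
split=> [Q_strong n x E|inj x].
  have [/andP[_]] := Q_strong x; rewrite /facial_walk => /uniq_map_inj inj _.
  apply: inj => //; last exact: in_orbit.
  by rewrite -fconnect_orbit fconnect_iter.
have inj_orbit : {in fingraph.orbit F x &, injective (@dtail G)}.
  move=> y z; rewrite -!fconnect_orbit => xy xz E.
  have : fconnect F y z by rewrite (connect_trans _ xz) // fconnect_sym.
  by move/iter_findex=> yz; rewrite -yz; apply/esym/inj; rewrite yz.
split; last first.
  have [ne1 ne2 ne3] := face_orbit_gt2 x Q_fix.
  rewrite size_map size_orbit -/F.
  have sub : [set x; F x; F (F x)] \subset fingraph.orbit F x.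
    apply/subsetP=> y; rewrite !inE -fconnect_orbit => /orP[/orP[]|] /eqP ->.
    - exact: connect0.
    - exact: fconnect1.
    - exact: (fconnect_iter _ 2).
  have := subset_leq_card sub; rewrite cards3; try by apply/nesym.
  by rewrite (card_uniqP (orbit_uniq _ _)) size_orbit.
rewrite /ucycle /facial_walk map_inj_in_uniq // orbit_uniq andbT cycle_map.
apply: sub_cycle (cycle_orbit F_inj x) => y z /eqP <- /=.
by rewrite dtail_face dart_adj.
Qed.

(** The duality on darts determines the one on vertices, and it transports
    rotations and facial walks directly. *)
Record dual_darts (H N : sgraph) (R : rotation N) (g : dart N -> dart H) : Prop :=
  DualDarts {
    dd_bij : bijective g;
    dd_rev : forall b, g (drev b) = drev (g b);
    dd_tail : forall b b',
      (b' \in porbit (face_perm R) b) = (dtail (g b) == dtail (g b')) }.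

Lemma is_dual_darts (H N : sgraph) (R : rotation N) : is_dual H R ->
  #|H| = #|faces R| /\ exists g : dart N -> dart H, dual_darts R g.
Proof.
case=> h [h_inj h_img h_adj].
split; first by rewrite -h_img card_imset // cardsT.
set f := face_perm R.
have h_face b : exists x, h x == porbit f b.
  have : porbit f b \in h @: [set: H] by rewrite h_img imset_f.
  by case/imsetP=> x _ ->; exists x.
pose t b := xchoose (h_face b).
have ht b : h (t b) = porbit f b := eqP (xchooseP (h_face b)).
have t_adj b : adj (t b) (t (drev b)).
  suff : 0 < (adj (t b) (t (drev b)) : nat) by case: (adj _ _).
  rewrite -h_adj card_gt0; apply/set0Pn; exists b.
  by rewrite inE !ht !porbit_id.
pose g b : dart H := exist _ (t b, t (drev b)) (t_adj b).
have tailE b x : (b \in h x) = (t b == x).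
  have hx : h x \in faces R by rewrite -h_img imset_f.
  have /imsetP[d _ hd] := hx; rewrite -(inj_eq h_inj) ht hd.
  by rewrite eq_porbit_mem.
have fiber x y b : (b \in [set d in h x | drev d \in h y]) =
    (t b == x) && (t (drev b) == y).
  by rewrite inE !tailE.
exists g; split.
- apply: inj_card_bij.
    move=> b b' E.
    have [E1 E2] : t b = t b' /\ t (drev b) = t (drev b').
      by split; [apply: (congr1 (@dtail H) E) | apply: (congr1 (@dhead H) E)].
    have /eqP/cards1P[c Ec] : #|[set d in h (t b) | drev d \in h (t (drev b))]| = 1.
      by rewrite h_adj t_adj.
    have: b \in [set c] by rewrite -Ec fiber !eqxx.
    have: b' \in [set c] by rewrite -Ec fiber E1 E2 !eqxx.
    by rewrite !inE => /eqP -> /eqP ->.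
  rewrite -(card_codom (f := fun z : dart H => z)) //.
  have sub : {subset [set: dart H] <= g @: [set: dart N]}.
    move=> z _; have : 0 < #|[set d in h (dtail z) | drev d \in h (dhead z)]|.
      by rewrite h_adj dart_adj.
    rewrite card_gt0 => /set0Pn[b]; rewrite fiber => /andP[/eqP t1 /eqP t2].
    by apply/imsetP; exists b => //; apply: dart_inj.
  have := subset_leq_card (introT subsetP sub).
  move/leq_trans/(_ (leq_imset_card _ _)); rewrite !cardsT.
  by rewrite card_codom.
- by move=> b; apply: dart_inj; rewrite //= /dhead /dtail /= drevK.
- move=> b b'; rewrite porbit_sym -eq_porbit_mem -!ht (inj_eq h_inj).
  by [].
Qed.

Section Transport.
Variables (H N : sgraph) (R : rotation N) (g : dart N -> dart H).
Hypotheses (f3 : triangular R) (gP : dual_darts R g).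
Variable Q : rotation H.
Local Notation f := (face_perm R).

Let g_inj : injective g := bij_inj (dd_bij gP).

Let g_tail b b' : dtail (g b) = dtail (g b') <-> [\/ b' = b, b' = f b | b' = f (f b)].
Proof.
split=> [/eqP|].
  rewrite -(dd_tail gP) (porbit_face f3 b).1 !inE => /orP[/orP[]|] /eqP ->;
  by [constructor 1|constructor 2|constructor 3].
move=> h; apply/eqP; rewrite -(dd_tail gP) (porbit_face f3 b).1 !inE.
by case: h => ->; rewrite eqxx ?orbT.
Qed.

Lemma dual_rot_neq x : Q x <> x.
Proof.
have [k kg gk] := dd_bij gP; rewrite -(gk x); move: (k x) => b E.
have /(rot_iter Q)[n] : dtail (g b) = dtail (g (f b)) by apply/g_tail; constructor 2.
suff -> : iter n Q (g b) = g b by move/g_inj/(face_neq (R := R)).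
by elim: n => //= n ->.
Qed.

(** A cubic vertex has only two rotations: that of the face of [R] which it is dual
    to, and the reverse. *)
Lemma dual_rotation_flip :
  exists2 s, face_invariant R s & forall b, Q (g b) = g (flip R s b).
Proof.
pose s b := Q (g b) != g (f b).
have sE b : Q (g b) = g (flip R s b).
  rewrite /flip /s; have [//|ne /=] := eqVneq (Q (g b)) (g (f b)).
  have [k kg gk] := dd_bij gP.
  have : dtail (g b) = dtail (g (k (Q (g b)))) by rewrite gk rot_tail.
  case/g_tail => E; first by case: (dual_rot_neq (x := g b)); rewrite -[LHS]gk E.
    by case/eqP: ne; rewrite -[LHS]gk E.
  by rewrite -[LHS]gk E.
exists s => // b.
have Q_inj x y : Q (g x) = Q (g y) -> x = y by move/perm_inj/g_inj.
have := sE b; have := sE (f b); have := sE (f (f b)).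
rewrite /flip !f3; case: (s b); case: (s (f b)) => // E3 E2 E1.
  by case: (face_neq (R := R) (d := b)); apply: Q_inj; rewrite E1.
case: (s (f (f b))) E3 => E3.
  by case: (face2_neq f3 (d := b)); apply: Q_inj; rewrite E3 E1.
by case: (face_neq (R := R) (d := f b)); apply: Q_inj; rewrite E2.
Qed.

Variable s : dart N -> bool.
Hypotheses (sf : face_invariant R s) (Qs : forall b, Q (g b) = g (flip R s b)).

Let Q_face b : face_perm Q (g b) = g (flip_step R s b).
Proof. by rewrite face_permE -(dd_rev gP) Qs. Qed.

Let Q_face_iter n b : iter n (face_perm Q) (g b) = g (iter n (flip_step R s) b).
Proof. by elim: n => //= n ->. Qed.

Lemma dual_strong : strong Q <-> strong_flip R s.
Proof.
apply: iff_trans (strongP dual_rot_neq) _; split=> [inj n b|ss n x].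
  split=> E; have := inj n (g b); rewrite Q_face_iter E => h.
    case: (face_neq (R := R) (d := b)); apply/g_inj/h/esym/g_tail.
    by constructor 2.
  case: (face2_neq f3 (d := b)); apply/g_inj/h/esym/g_tail.
  by constructor 3.
have [k kg gk] := dd_bij gP; rewrite -(gk x) Q_face_iter => /esym/g_tail.
by have [h1 h2] := ss n (k x); case=> // ->.
Qed.

Lemma dual_face_label (T : finType) (l : dart N -> T) :
  (forall b b', (exists n, b' = iter n (flip_step R s) b) <-> l b = l b') ->
  (forall t, exists b, l b = t) -> #|faces Q| = #|T|.
Proof.
have [k kg gk] := dd_bij gP => lP l_onto.
apply: (card_porbits_label (l := l \o k)) => [x y|t]; last first.
  by have [b <-] := l_onto t; exists (g b); rewrite /= kg.
apply/porbit_iterP/eqP => /= [[n Ey]|/lP[n En]].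
  by apply/lP; exists n; apply: g_inj; rewrite -Q_face_iter !gk.
by exists n; rewrite -(gk x) Q_face_iter -En gk.
Qed.

(** Without reversals the facial walks turn around the tails of the darts, and with
    all faces reversed they turn backwards around the heads. *)
Lemma dual_faces_const (no_iso : forall x : N, exists d, dtail d = x) :
  (forall d d', s d = s d') -> #|faces Q| = #|N|.
Proof.
move=> s_const.
case: (pickP (fun d : dart N => s d)) => [d0 sd0|s0].
  have s1 d : s d by rewrite (s_const d d0).
  apply: (dual_face_label (l := @dhead N)) => [b b'|x]; last first.
    by have [d <-] := no_iso x; exists (drev d).
  pose Ri := ((R : {perm dart N})^-1)%g.
  have stepV d : Ri (drev d) = drev (flip_step R s d).
    apply: (@perm_inj _ R); rewrite permKV rot_face drevK /flip_step /flip s1.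
    by rewrite f3.
  have iterV n d : iter n Ri (drev d) = drev (iter n (flip_step R s) d).
    by elim: n => //= n ->; rewrite stepV.
  have -> : (dhead b = dhead b') <-> (drev b' \in porbit Ri (drev b)).
    by rewrite porbitV rot_porbit !dtail_rev; split=> [->|/eqP].
  split=> [[n ->]|/porbit_iterP[n]].
    by apply/porbit_iterP; exists n; rewrite iterV.
  by rewrite iterV => /(can_inj (@drevK N)) ->; exists n.
apply: (dual_face_label (l := @dtail N)) => // b b'.
have step d : flip_step R s d = R d by rewrite /flip_step /flip s0 rot_face.
have iterE n d : iter n (flip_step R s) d = iter n R d.
  by elim: n => //= n ->; rewrite step.
split=> [[n ->]|/(rot_iter R)[n ->]]; last by exists n.
by apply/eqP; rewrite -(rot_porbit R); apply/porbit_iterP; exists n.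
Qed.

End Transport.

Lemma apollonian_dual_genus (H : sgraph) (Q : rotation H) g :
  apollonian_dual H -> has_genus Q g -> strong Q -> g = 0.
Proof.
case=> N [R [R_apo R_dual]] Qg Q_strong.
have [f3 cardN no_iso rigid] := apollonian_rigid R_apo.
have [cardH [k kP]] := is_dual_darts R_dual.
have [s sf Qs] := dual_rotation_flip f3 kP Q.
have ss : strong_flip R s by apply/(dual_strong f3 kP Qs).
have cardQ := dual_faces_const f3 kP Qs no_iso (rigid s sf ss).
have card3 := card_faces_triangular f3.
have cardD : #|dart N| = #|dart H| by apply: bij_eq_card (dd_bij kP).
move/has_genus_darts: Qg; rewrite cardQ cardH -cardD.
by move: cardN card3; lia.
Qed.

(** * Even holes give strong embeddings *)

(** The induced subgraph on [W] is a disjoint union of even cycles; describing it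
    by degrees and a colouring avoids an order on its vertices. *)
Record even_hole (N : sgraph) (W : {set N}) : Prop := EvenHole {
  hole_nonempty : exists x, x \in W;
  hole_degree : forall x, x \in W -> #|[set y in W | adj x y]| = 2;
  hole_bipartite : exists col : N -> bool,
    forall x y, x \in W -> y \in W -> adj x y -> col x = ~~ col y }.

Section EvenHoleFlip.
Variables (N : sgraph) (R : rotation N) (W : {set N}) (col : N -> bool).
Hypothesis f3 : triangular R.
Hypothesis W_nonempty : exists x, x \in W.
Hypothesis W_degree : forall x, x \in W -> #|[set y in W | adj x y]| = 2.
Hypothesis W_col : forall x y, x \in W -> y \in W -> adj x y -> col x = ~~ col y.

Definition inner_dart d := (dtail d \in W) && (dhead d \in W).

Lemma inner_dart_rev d : inner_dart (drev d) = inner_dart d.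
Proof. exact: andbC. Qed.

Lemma card_inner_dart x :
  #|[set d : dart N | (dtail d == x) && inner_dart d]| = if x \in W then 2 else 0.
Proof.
case: ifP => xW; last first.
  apply: eq_card0 => d; rewrite !inE /inner_dart; case: eqP => //= ->.
  by rewrite xW.
rewrite -(W_degree xW); set A := [set d | _].
have -> : [set y in W | adj x y] = @dhead N @: A.
  apply/setP=> y; rewrite inE; apply/andP/imsetP => [[yW /dart_of[d dx dy]]|[d]].
    by exists d => //; rewrite inE /inner_dart dx dy eqxx xW.
  by rewrite inE => /andP[/eqP dx /andP[_ dW]] ->; rewrite -dx dart_adj.
rewrite card_in_imset // => d d'; rewrite !inE => /andP[/eqP dx _] /andP[/eqP dx' _].
by apply: dart_inj; rewrite dx.
Qed.

Lemma inner_dart_at x : x \in W -> exists2 d, dtail d = x & inner_dart d.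
Proof.
move=> xW; have := card_inner_dart x; rewrite xW.
case: (set_0Vmem [set d : dart N | (dtail d == x) && inner_dart d]) => [->|[d]].
  by rewrite cards0.
by rewrite inE => /andP[/eqP dx dW] _; exists d.
Qed.

Variable s : dart N -> bool.
Hypotheses (sf : face_invariant R s)
  (s_inner : forall d, inner_dart d = s d (+) s (drev d)).
Local Notation f := (face_perm R).
Local Notation p := (flip_step R s).

Let P : {perm dart N} := perm (flip_step_inj sf).
Let PE d : P d = p d. Proof. by rewrite permE. Qed.
Let P_iter n d : iter n P d = iter n p d.
Proof. by elim: n => //= n ->; rewrite PE. Qed.

(** The new facial walk through [d] turns around the vertex [before d] of [N] when
    it arrives at [d], and around [after d] when it leaves [d]: it turns forwards
    in the faces outside [s] and backwards in those of [s]. *)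
Let before d := if s d then dhead d else dtail d.
Let after d := if s (drev d) then dhead d else dtail d.

Let s_step d : s (p d) = s (drev d).
Proof. by rewrite /flip_step /flip; case: ifP; rewrite !sf. Qed.

Let before_step d : before (p d) = after d.
Proof.
rewrite /before s_step /after /flip_step /flip; case: (s (drev d)).
  by rewrite (dhead_face2 f3).
by rewrite dtail_face.
Qed.

Let after_noninner d : ~~ inner_dart d -> s (drev d) = s d /\ after d = before d.
Proof.
by rewrite s_inner /after /before; case: (s d); case: (s (drev d)).
Qed.

Let after_inner d : inner_dart d ->
  [/\ s (drev d) = ~~ s d, before d \in W, after d \in W, after d <> before d &
      col (after d) = ~~ col (before d)].
Proof.
move=> d_in; have := d_in; rewrite s_inner /after /before.
case/andP: d_in => tW hW; have dW := dart_adj d.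
have hd : adj (dhead d) (dtail d) by rewrite adj_sym.
have ne := dart_irrefl d.
by case: (s d); case: (s (drev d)) => // _; split=> //;
  [exact: W_col | exact: nesym | exact: W_col].
Qed.

(** A new facial walk moves to another vertex exactly when it crosses an edge of
    the hole, and then both the colour and the side of the hole change.  So a walk
    that meets [W] preserves the sum of the colour and the side, and any other walk
    stays at one vertex. *)
Let walk_type d : N + bool :=
  if before d \in W then inr (col (before d) (+) s d) else inl (before d).

Let walk_type_step d : walk_type (p d) = walk_type d.
Proof.
rewrite /walk_type before_step s_step.
case: (boolP (inner_dart d)) => [/after_inner[-> -> -> _ ->]|/after_noninner[-> ->]] //.
by rewrite addbN addNb negbK.
Qed.

Let adj_before_face d : adj (before d) (before (f d)).
Proof.
rewrite /before sf; case: ifP => _; last by rewrite dtail_face dart_adj.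
by rewrite -[dhead d](dtail_face R) dart_adj.
Qed.

Let before_neighbour_type d d' :
  adj (before d) (before d') -> s d = s d' -> walk_type d <> walk_type d'.
Proof.
move=> dd' sE; rewrite /walk_type.
case: ifP => dW; case: ifP => d'W // -[E].
  by move: E; rewrite sE (W_col dW d'W dd'); case: (col _); case: (s _).
by move: dd'; rewrite E adj_irrefl.
Qed.

(** Two visits of a walk to one face would be at adjacent vertices of [N] and on the
    same side of the hole, which the preserved type excludes. *)
Lemma even_hole_strong : strong_flip R s.
Proof.
have typeE n d : walk_type (iter n p d) = walk_type d.
  by elim: n => //= n <-; rewrite walk_type_step.
move=> n d; split=> E; have := typeE n d; rewrite E.
  by apply/nesym/before_neighbour_type; rewrite ?sf //; apply: adj_before_face.
apply: before_neighbour_type; rewrite ?sf // -{2}(f3 d).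
exact: adj_before_face.
Qed.

(** As long as a walk crosses no edge of the hole at [x] it keeps turning around the same
    vertex [x] in the same direction, so it runs through all darts at [x]. *)
Let turn_around d x t :
  after d = x -> s (drev d) = t ->
  (forall d', d' \in porbit P d -> inner_dart d' -> before d' <> x) ->
  forall d0, (if t then dhead d0 else dtail d0) = x ->
  [/\ d0 \in porbit P d, s d0 = t & before d0 = x].
Proof.
move=> dx dt none.
have stay n : after (iter n p d) = x /\ s (drev (iter n p d)) = t.
  elim: n => // n [IHx IHt]; rewrite iterS.
  have in_orb : p (iter n p d) \in porbit P d.
    by apply/porbit_iterP; exists n.+1; rewrite P_iter.
  case: (boolP (inner_dart (p (iter n p d)))) => [/(none _ in_orb) []|].
    by rewrite before_step.
  by case/after_noninner=> -> ->; rewrite s_step before_step.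
move=> d0 d0x; suff [n d0E] : exists n, d0 = iter n.+1 p d.
  split; first by apply/porbit_iterP; exists n.+1; rewrite P_iter.
    by rewrite d0E s_step; case: (stay n).
  by rewrite d0E before_step; case: (stay n).
case tE: t d0x => d0x; last first.
  have turn n : iter n p d = iter n R d.
    elim: n => //= n <-; rewrite /flip_step /flip; have [_ ->] := stay n.
    by rewrite tE rot_face.
  have td : dtail (R d) = dtail d0.
    by rewrite rot_tail d0x -dx /after dt tE.
  by have [n ->] := rot_iter R td; exists n; rewrite turn iterSr.
pose Ri := ((R : {perm dart N})^-1)%g.
have turn n : drev (iter n p d) = iter n Ri (drev d).
  elim: n => //= n <-; apply: (@perm_inj _ R); rewrite permKV rot_face drevK.
  by rewrite /flip_step /flip; have [_ ->] := stay n; rewrite tE f3.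
have : drev d0 \in porbit Ri (Ri (drev d)).
  rewrite porbitV rot_porbit -[dtail (Ri _)](rot_tail R) permKV !dtail_rev.
  by rewrite d0x -dx /after dt tE.
case/porbit_iterP=> n; rewrite -iterSr -turn => /(can_inj (@drevK N)) ->.
by exists n.
Qed.

Let next_inner d : after d \in W ->
  exists d', [/\ d' \in porbit P d, inner_dart d' & before d' = after d].
Proof.
move=> dW; pose good d' := [&& d' \in porbit P d, inner_dart d' & before d' == after d].
case: (pickP good) => [d' /and3P[h1 h2 /eqP h3]|none]; first by exists d'.
have none' d' : d' \in porbit P d -> inner_dart d' -> before d' <> after d.
  by move=> h1 h2 h3; have := none d'; rewrite /good h1 h2 h3 eqxx.
have [d0 d0x d0W] := inner_dart_at dW.
case tE: (s (drev d)).
  have [|h1 h2 h3] := turn_around erefl tE none' (d0 := drev d0) => //.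
  by case: (none' (drev d0)) => //; rewrite inner_dart_rev.
have [|h1 h2 h3] := turn_around erefl tE none' (d0 := d0) => //.
by case: (none' d0).
Qed.

Let prev d : exists d', p d' = d.
Proof. by exists (P^-1 d)%g; rewrite -PE permKV. Qed.

(** Consecutive crossings of the hole start from distinct vertices, so a walk with
    only two crossings would cross one edge in both directions; this is impossible
    in a strong embedding. *)
Let orbit_inner_gt2 d : before d \in W ->
  2 < #|[set d' | inner_dart d' & porbit P d' == porbit P d]|.
Proof.
have [d0 <-] := prev d; rewrite before_step => d0W.
have [d1 [o1 i1 _]] := next_inner d0W.
have [_ b1 a1 ne1 _] := after_inner i1.
have [d2 [o2 i2 e2]] := next_inner a1.
have [_ b2 a2 ne2 _] := after_inner i2.
have [d3 [o3 i3 e3]] := next_inner a2.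
have O0 : porbit P (p d0) = porbit P d0.
  by apply/eqP; rewrite eq_porbit_mem -PE porbit_stable.
have O1 : porbit P d1 = porbit P d0 by apply/eqP; rewrite eq_porbit_mem.
have O2 : porbit P d2 = porbit P d0 by apply/eqP; rewrite -O1 eq_porbit_mem.
have O3 : porbit P d3 = porbit P d0 by apply/eqP; rewrite -O2 eq_porbit_mem.
have n12 : d1 <> d2 by move=> E; apply: ne1; rewrite -e2 -E.
rewrite -(@cards3 _ d1 d2 d3).
- apply: subset_leq_card; apply/subsetP=> x.
  by rewrite !inE => /orP[/orP[]|] /eqP ->; rewrite ?O1 ?O2 ?O3 O0 eqxx ?i1 ?i2 ?i3.
- exact: n12.
- move=> E; have d2E : d2 = drev d1.
    move: e2 e3; rewrite -E /before /after.
    have [-> _ _ _ _] := after_inner i1; have [-> _ _ _ _] := after_inner i2.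
    case: (s d1); case: (s d2) => /= h1 h2; try exact: dart_inj;
      by case: n12; apply: dart_inj.
  have : d1 \in porbit P d2 by rewrite -eq_porbit_mem O1 O2.
  case/porbit_iterP=> n; rewrite P_iter d2E => d1E.
  have [s1 s2] := even_hole_strong n.+1 (drev d1).
  move: s1 s2; rewrite /= -d1E /flip_step /flip; by case: (s _).
- by move=> E; apply: ne2; rewrite -e3 E.
Qed.

Let card_inner : #|[set d | inner_dart d]| = #|W| * 2.
Proof.
rewrite -sum1_card (partition_big (@dtail N) (mem W)) /=; last first.
  by move=> d; rewrite inE => /andP[].
rewrite -sum_nat_const; apply: eq_bigr => x xW.
have := card_inner_dart x; rewrite xW -sum1_card => <-.
by apply: eq_bigl => d; rewrite !inE andbC.
Qed.

(** The walks away from [W] correspond to the vertices outside [W].  The others have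
    at least three of the [2 * #|W|] darts of the hole each, so that there are fewer
    of them than vertices in [W]. *)
Lemma even_hole_few_faces : exists2 q : {perm dart N},
  q =1 flip_step R s & #|porbits q| < #|N|.
Proof.
exists P => //.
pose P1 := [set porbit P d | d in [set d | before d \in W]].
pose P0 := [set porbit P d | d in [set d | before d \notin W]].
have card1 : #|P1| * 3 <= #|W| * 2.
  rewrite -card_inner -[X in _ <= X]sum1_card (partition_big (porbit P) (mem P1)) /=.
    rewrite -sum_nat_const; apply: leq_sum => A /imsetP[d]; rewrite inE => dW ->{A}.
    rewrite sum1dep_card; apply: leq_trans (orbit_inner_gt2 dW) _.
    by apply: subset_leq_card; apply/subsetP=> x; rewrite !inE.
  by move=> d; rewrite inE => /after_inner[_ dW _ _ _]; apply: imset_f; rewrite inE.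
have card0 : #|P0| <= #|~: W|.
  pose F x := if [pick d | before d == x] is Some d then porbit P d else set0.
  apply: leq_trans (leq_imset_card F _); apply: subset_leq_card.
  apply/subsetP=> A /imsetP[d]; rewrite inE => dW ->{A}.
  apply/imsetP; exists (before d); rewrite ?inE // /F.
  case: pickP => [d' /eqP E|/(_ d)]; last by rewrite eqxx.
  have [b bd] := prev d; have Eb : after b = before d by rewrite -bd before_step.
  have none d1 : d1 \in porbit P b -> inner_dart d1 -> before d1 <> before d.
    by move=> _ /after_inner[_ d1W _ _ _] E1; case/negP: dW; rewrite -E1.
  have turn := turn_around Eb erefl none.
  have db : porbit P d = porbit P b.
    by apply/eqP; rewrite eq_porbit_mem -bd -PE porbit_stable.
  suff sE : s d' = s (drev b).
    have [|d'b _ _] := turn d'; first by rewrite -sE -E.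
    by rewrite db; apply/esym/eqP; rewrite eq_porbit_mem.
  apply/eqP/negP=> /negP ne.
  have [|_ s1 _] := turn (drev d').
    by rewrite -E /before; case: (s d') ne; case: (s (drev b)).
  suff : inner_dart d' by case/after_inner=> _ d'W _ _ _; move: dW; rewrite -E d'W.
  by rewrite s_inner s1; case: (s d') ne; case: (s (drev b)).
have [x xW] := W_nonempty.
have W_gt0 : 0 < #|W| by rewrite card_gt0; apply/set0Pn; exists x.
have sub : porbits P \subset P0 :|: P1.
  apply/subsetP=> _ /imsetP[d _ ->]; rewrite inE.
  by case: (boolP (before d \in W)) => dW; apply/orP; [right|left];
    apply: imset_f; rewrite inE.
have := leq_trans (subset_leq_card sub) (leq_card_setU _ _).
by have := cardsC W; move: card1 card0 W_gt0; lia.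
Qed.

End EvenHoleFlip.

Lemma even_hole_flip (N : sgraph) (R : rotation N) (W : {set N}) :
  triangular R -> connected N -> 1 < #|N| -> has_genus R 0 -> even_hole W ->
  exists s, [/\ face_invariant R s, strong_flip R s &
    exists2 q : {perm dart N}, q =1 flip_step R s & #|porbits q| < #|N|].
Proof.
move=> f3 N_conn N_gt1 R_sphere [W_ne W_deg [col W_col]].
have [||s [sf s_inner]] := jordan_sphere (c := inner_dart W) N_conn N_gt1 R_sphere.
- exact: inner_dart_rev.
- by move=> x; rewrite card_inner_dart //; case: ifP.
exists s; split=> //; first exact: (even_hole_strong f3 W_col sf s_inner).
exact: (even_hole_few_faces f3 W_ne W_deg W_col sf s_inner).
Qed.

(** * Vertices all of whose triangles are faces *)

Section InnermostTriangle.
Variables (N : sgraph) (R : rotation N).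
Hypotheses (f3 : triangular R) (N_conn : connected N) (N_gt3 : 3 < #|N|)
  (N_sphere : has_genus R 0).
Local Notation f := (face_perm R).
Implicit Types (t : {set N}) (s : dart N -> bool).

Definition triangle t := (#|t| == 3) &&
  [forall x in t, forall y in t, (x != y) ==> adj x y].

Definition facial t := [exists d, t == [set dtail d; dtail (f d); dtail (f (f d))]].

Definition bounds s t :=
  face_invariant R s /\ forall d, inner_dart t d = s d (+) s (drev d).

Definition interior s t :=
  [set w in ~: t | [forall d : dart N, (dtail d == w) ==> s d]].

Lemma triangle_adj t x y : triangle t -> x \in t -> y \in t -> x != y -> adj x y.
Proof. by case/andP=> _ /forall_inP/(_ x) h /h /forall_inP/(_ y) h' /h' /implyP. Qed.

Lemma triangle_degree t : triangle t ->
  forall x, x \in t -> #|[set y in t | adj x y]| = 2.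
Proof.
move=> tt x xt; have -> : [set y in t | adj x y] = t :\ x.
  apply/setP=> y; rewrite !inE andbC; case yt: (y \in t); rewrite ?andbF // !andbT.
  apply/idP/idP => [|yx]; last by apply: (triangle_adj tt) => //; rewrite eq_sym.
  by apply: contraTneq => ->; rewrite adj_irrefl.
by have := cardsD1 x t; rewrite xt (eqP (andP tt).1) => -[].
Qed.

Lemma triangle3 x y z : adj x y -> adj y z -> adj z x -> triangle [set x; y; z].
Proof.
move=> xy yz zx; have ne (a b : N) : adj a b -> a <> b by move=> ab E; rewrite E adj_irrefl in ab.
apply/andP; split; first by rewrite (cards3 (ne _ _ xy) (nesym (ne _ _ zx)) (ne _ _ yz)).
apply/forall_inP=> a; rewrite !inE => /orP[/orP[]|] /eqP ->;
apply/forall_inP=> b; rewrite !inE => /orP[/orP[]|] /eqP ->;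
by rewrite ?eqxx // ?xy ?yz ?zx ?implybT // adj_sym ?xy ?yz ?zx ?implybT.
Qed.

Lemma triangle_bounds t : triangle t -> exists s, bounds s t.
Proof.
move=> tt; have [|||s [sf s_in]] := jordan_sphere (c := inner_dart t) N_conn _ N_sphere.
- by apply: leq_trans N_gt3.
- exact: inner_dart_rev.
- move=> x; rewrite (card_inner_dart (triangle_degree tt)); by case: ifP.
by exists s.
Qed.

Lemma bounds_compl s t : bounds s t -> bounds (fun d => ~~ s d) t.
Proof.
case=> sf s_in; split=> d; first by rewrite sf.
by rewrite s_in addNb addbN negbK.
Qed.

Lemma bounds_const s t d d' : bounds s t -> dtail d \notin t ->
  dtail d = dtail d' -> s d = s d'.
Proof.
case=> sf s_in dt /(rot_iter R)[n ->]; elim: n => //= n ->.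
have nt : dtail (iter n R d) \notin t.
  by have -> // : dtail (iter n R d) = dtail d by elim: n => //= n <-; rewrite rot_tail.
have := s_in (iter n R d); rewrite /inner_dart (negPf nt) /= rot_face sf.
by case: (s _); case: (s _).
Qed.

Lemma interiorP s t d : bounds s t -> dtail d \notin t ->
  (dtail d \in interior s t) = s d.
Proof.
move=> st dt; rewrite !inE dt /=; apply/forallP/idP => [/(_ d)|sd d'].
  by rewrite eqxx.
by apply/implyP=> /eqP E; rewrite -(bounds_const st dt (esym E)).
Qed.

Lemma interior_dart s t d : dtail d \in interior s t -> s d.
Proof. by rewrite !inE => /andP[_ /forallP/(_ d)]; rewrite eqxx. Qed.

Lemma interior_notin s t w : w \in interior s t -> w \notin t.
Proof. by rewrite !inE => /andP[]. Qed.

Lemma interior_adj s t u v : bounds s t ->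
  u \in interior s t -> adj u v -> v \notin t -> v \in interior s t.
Proof.
move=> st uI /dart_of[d du dv] vt; rewrite -du in uI; rewrite -dv -dtail_rev in vt *.
rewrite (interiorP st vt).
have [_ /(_ d)] := st; rewrite /inner_dart (negPf (interior_notin uI)) /=.
by rewrite (interior_dart uI); case: (s _).
Qed.

(** The reversal of [d] lies in the same face as [R d], so each face at [x] is
    counted twice. *)
Lemma boundary_even s x : face_invariant R s ->
  \big[addb/false]_(d | dtail d == x) (s d (+) s (drev d)) = false.
Proof.
move=> sf; rewrite big_split /=.
rewrite [X in X (+) _](reindex_inj (@perm_inj _ R)) /=.
rewrite (eq_bigl (fun d => dtail d == x)) => [|d]; last by rewrite rot_tail.
under eq_bigr => d _ do rewrite rot_face sf.
exact: addbb.
Qed.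

(** At each corner of the triangle the boundary contains both edges or neither, as
    its degree there is even. *)
Lemma boundary_in_triangle s t : triangle t -> face_invariant R s ->
  (forall d, ~~ inner_dart t d -> s d = s (drev d)) ->
  forall d d', inner_dart t d -> inner_dart t d' ->
  s d (+) s (drev d) = s d' (+) s (drev d').
Proof.
move=> tt sf s_out.
have same_tail d d' : inner_dart t d -> inner_dart t d' -> dtail d = dtail d' ->
    s d (+) s (drev d) = s d' (+) s (drev d').
  move=> d_in d'_in E; have [-> //|ne] := eqVneq d' d.
  have := boundary_even (dtail d) sf; rewrite (bigD1 d) //= (bigD1 d') /=; last first.
    by rewrite E eqxx.
  rewrite big1 => [|a /andP[/andP[/eqP ta ad] ad']].
    by rewrite addbF; case: (s d (+) _); case: (s d' (+) _).
  case: (boolP (inner_dart t a)) => [a_in|/s_out ->]; last by rewrite addbb.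
  have [[[tW hW] [_ hW']] [_ aW]] := (andP d_in, andP d'_in, andP a_in).
  have t_eq : [set dtail d; dhead d; dhead d'] = t.
    apply/eqP; rewrite eqEcard (eqP (andP tt).1) cards3 ?andbT.
    - by apply/subsetP=> y; rewrite !inE => /orP[/orP[]|] /eqP ->.
    - exact: dart_irrefl.
    - by rewrite E; apply: dart_irrefl.
    - by move=> hh; case/eqP: ne; apply: dart_inj.
  move: aW; rewrite -t_eq !inE => /orP[/orP[]|] /eqP ha.
  - by case: (dart_irrefl a); rewrite ha ta.
  - by case/eqP: ad; apply: dart_inj.
  - by case/eqP: ad'; apply: dart_inj; rewrite // ta.
have rev_in d : inner_dart t d -> inner_dart t (drev d) by rewrite inner_dart_rev.
have bE d : s d (+) s (drev d) = s (drev d) (+) s (drev (drev d)).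
  by rewrite drevK addbC.
move=> d d' d_in d'_in.
have [E|ne1] := eqVneq (dtail d) (dtail d'); first exact: same_tail.
have [E|ne2] := eqVneq (dhead d) (dtail d').
  by rewrite bE; apply: same_tail => //; apply: rev_in.
have [E|ne3] := eqVneq (dtail d) (dhead d').
  by rewrite [RHS]bE; apply: same_tail => //; apply: rev_in.
rewrite bE [RHS]bE; apply: same_tail; rewrite ?rev_in // !dtail_rev.
have [[tW hW] [tW' hW']] := (andP d_in, andP d'_in).
have t_eq : [set dtail d; dhead d; dtail d'] = t.
  apply/eqP; rewrite eqEcard (eqP (andP tt).1) cards3 ?andbT; try exact/eqP.
    by apply/subsetP=> y; rewrite !inE => /orP[/orP[]|] /eqP ->.
  exact: dart_irrefl.
move: hW'; rewrite -t_eq !inE eq_sym (negPf ne3) /= => /orP[] /eqP // E.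
by case: (dart_irrefl d').
Qed.

(** No edge of [t'] separates two faces outside [t], since its vertices lie in [t]
    or in the interior of [t].  So the part of one side of [t'] which is outside [t]
    has its boundary in [t], and it is empty or all of the outside of [t]. *)
Lemma nested_triangle s t t' u : triangle t -> bounds s t -> triangle t' ->
  u \in interior s t -> u \in t' ->
  exists2 s', bounds s' t' & forall d, s' d -> s d.
Proof.
move=> tt st tt' uI ut'; have [s' st'] := triangle_bounds tt'.
have [[sf s_in] [sf' s_in']] := (st, st').
have [d0 d0u] := connected_dart u N_conn (ltn_trans (isT : 1 < 3) N_gt3).
have sd0 : s d0 by apply: (@interior_dart _ t); rewrite d0u.
have t'_sub p : p \in t' -> p \notin t -> p \in interior s t.
  move=> pt' pt; have [-> //|pu] := eqVneq p u.
  by apply: (interior_adj st uI _ pt); apply: triangle_adj tt' ut' pt' _; rewrite eq_sym.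
pose r d := ~~ s d && s' d.
have rf : face_invariant R r by move=> d; rewrite /r sf sf'.
have r_out d : ~~ inner_dart t d -> r d = r (drev d).
  move=> d_out; have sE : s (drev d) = s d.
    by have := s_in d; rewrite (negPf d_out); case: (s d); case: (s _).
  rewrite /r sE; case sd: (s d) => //=; apply/eqP/negP=> /negP ne.
  have : inner_dart t' d by rewrite s_in'; case: (s' d) ne; case: (s' _).
  case/andP=> tl hd; case/negP: d_out; apply/andP; split.
    by apply/negPn/negP=> /(t'_sub _ tl)/interior_dart; rewrite sd.
  by apply/negPn/negP=> /(t'_sub _ hd)/(@interior_dart _ _ (drev d)); rewrite sE sd.
have [x xt] : exists x, x \in t.
  by apply/set0Pn; rewrite -cards_eq0 (eqP (andP tt).1).
have [a _ a_in] := inner_dart_at (triangle_degree tt) xt.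
have r_in d : inner_dart t d -> r d (+) r (drev d) = r a (+) r (drev a).
  by move=> d_in; apply: boundary_in_triangle tt rf r_out _ _ d_in a_in.
case ra: (r a (+) r (drev a)).
  exists (fun d => ~~ s' d); first exact: bounds_compl.
  have sum_const d : r d (+) s d = r d0 (+) s d0.
    have sum_rev b : r (drev b) (+) s (drev b) = r b (+) s b.
      case: (boolP (inner_dart t b)) => b_in.
        have := r_in b b_in; have := s_in b; rewrite ra b_in.
        by case: (r b); case: (r _); case: (s b); case: (s _).
      have := s_in b; rewrite (negPf b_in) (r_out _ b_in).
      by case: (s b); case: (s _).
    apply: (connected_darts (R := R) (t := fun b => r b (+) s b)) => // b.
    by rewrite rot_face rf sf.
  by move=> d; have := sum_const d; rewrite /r sd0; case: (s d); case: (s' d).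
exists s' => // d s'd.
have : r d = r d0.
  have r_rev b : r (drev b) = r b.
    case: (boolP (inner_dart t b)) => [/r_in|/r_out //].
    by rewrite ra; case: (r b); case: (r _).
  apply: (connected_darts (R := R)) => // b; by rewrite rot_face rf.
by rewrite /r sd0 s'd andbT => /negbFE.
Qed.

(** The side of [t'] which is contained in that of [t] has an interior vertex, for
    otherwise its only face would be [t'], and its interior misses [u]. *)
Lemma smaller_interior s t t' u : triangle t -> bounds s t -> triangle t' ->
  u \in interior s t -> u \in t' -> ~~ facial t' ->
  exists s', [/\ bounds s' t', interior s' t' != set0 &
    #|interior s' t'| < #|interior s t|].
Proof.
move=> tt st tt' uI ut' t'_face.
have [s' st' s's] := nested_triangle tt st tt' uI ut'; exists s'.
have [[sf s_in] [sf' s_in']] := (st, st').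
split=> //.
  have [a _ a_in] := inner_dart_at (triangle_degree tt') ut'.
  have [d s'd] : exists d, s' d.
    move: a_in; rewrite s_in'; case s'a: (s' a); first by exists a.
    by exists (drev a).
  apply/set0Pn; case: (boolP (dtail d \in t')) => d1; last first.
    by exists (dtail d); rewrite (interiorP st').
  case: (boolP (dtail (f d) \in t')) => d2; last first.
    by exists (dtail (f d)); rewrite (interiorP st') // sf'.
  case: (boolP (dtail (f (f d)) \in t')) => d3; last first.
    by exists (dtail (f (f d))); rewrite (interiorP st') // !sf'.
  case/negP: t'_face; apply/existsP; exists d; rewrite eq_sym eqEcard.
  have n1 : dtail d <> dtail (f d) by rewrite dtail_face; apply: dart_irrefl.
  have n2 : dtail d <> dtail (f (f d)).
    by rewrite -{1}(dhead_face2 f3 d); apply/nesym/dart_irrefl.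
  have n3 : dtail (f d) <> dtail (f (f d)).
    by rewrite (dtail_face R (f d)); apply: dart_irrefl.
  rewrite (eqP (andP tt').1) (cards3 n1 n2 n3) andbT.
  by apply/subsetP=> y; rewrite !inE => /orP[/orP[]|] /eqP ->.
apply: proper_card.
rewrite properE; apply/andP; split; last first.
  by apply/subsetPn; exists u; rewrite // !inE ut'.
apply/subsetP=> w wI'; have ws d : dtail d = w -> s d.
  by move=> dw; apply/s's/(@interior_dart _ t'); rewrite dw.
rewrite !inE; apply/andP; split; last first.
  by apply/forallP=> d; apply/implyP=> /eqP; apply: ws.
apply/negP=> wt; have [d dw d_in] := inner_dart_at (triangle_degree tt) wt.
have := s_in d; rewrite d_in (ws d dw) /= -sf -rot_face.
by rewrite ws // rot_tail.
Qed.

(** Start from a face and the side of it that contains some other vertex, and pass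
    to triangles with smaller interior. *)
Lemma innermost_triangle : exists t s, [/\ triangle t, bounds s t,
  interior s t != set0 &
  forall t' u, triangle t' -> u \in t' -> u \in interior s t -> facial t'].
Proof.
have [t [s [tt st I_ne]]] : exists t s, [/\ triangle t, bounds s t & interior s t != set0].
  have N_gt1 : 1 < #|N| by apply: ltn_trans N_gt3.
  have [x _] : exists x : N, x \in N by apply/card_gt0P/ltn_trans/N_gt3.
  have [d _] := connected_dart x N_conn N_gt1.
  set t := [set dtail d; dtail (f d); dtail (f (f d))].
  have tt : triangle t.
    apply: triangle3.
    - by rewrite (dtail_face R d) dart_adj.
    - by rewrite (dtail_face R (f d)) dart_adj.
    - by rewrite -[in X in adj _ X](dhead_face2 f3 d) dart_adj.
  have [w wt] : exists w, w \in ~: t.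
    apply/set0Pn; rewrite -card_gt0; have := cardsC t.
    by rewrite (eqP (andP tt).1); move: N_gt3; lia.
  have [b bw] := connected_dart w N_conn N_gt1.
  have [s st] := triangle_bounds tt.
  rewrite inE -bw in wt; case sb: (s b).
    by exists t, s; split=> //; apply/set0Pn; exists (dtail b); rewrite interiorP.
  exists t, (fun d => ~~ s d); split=> //; first exact: bounds_compl.
  by apply/set0Pn; exists (dtail b); rewrite interiorP ?sb //; apply: bounds_compl.
have [n] := ubnP #|interior s t|.
elim: n => // n IH in t s tt st I_ne *; rewrite ltnS => I_le.
pose bad (p : {set N} * N) :=
  [&& triangle p.1, p.2 \in p.1, p.2 \in interior s t & ~~ facial p.1].
case: (pickP bad) => [[t' u] /and4P[/= tt' ut' uI t'_face]|none].
  have [s' [st' I'_ne I'_lt]] := smaller_interior tt st tt' uI ut' t'_face.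
  by apply: (IH t' s') => //; apply: leq_trans I_le.
exists t, s; split=> // t' u tt' ut' uI; case: (boolP (facial t')) => // t'_face.
by have := none (t', u); rewrite /bad /= tt' ut' uI t'_face.
Qed.

(** The triangles at the vertex [u] are exactly the faces at [u]. *)
Definition wheel u := forall d d', dtail d = u -> dtail d' = u ->
  adj (dhead d) (dhead d') -> d' = R d \/ d = R d'.

Lemma facial_wheel u :
  (forall t, triangle t -> u \in t -> facial t) -> wheel u.
Proof.
move=> u_face d d' du d'u dd'.
have : facial [set u; dhead d; dhead d'].
  apply: u_face; last by rewrite !inE eqxx.
  by apply: triangle3; rewrite // -?du ?dart_adj // du -d'u adj_sym dart_adj.
case/existsP=> a /eqP t_eq.
have [b bu t_eqb] : exists2 b, dtail b = u & [set u; dhead d; dhead d'] =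
    [set dtail b; dtail (f b); dtail (f (f b))].
  have : u \in [set u; dhead d; dhead d'] by rewrite !inE eqxx.
  rewrite {1}t_eq !inE => /orP[/orP[]|] /eqP E.
  - by exists a.
  - exists (f a); first by rewrite E.
    by rewrite t_eq f3; apply/setP=> x; rewrite !inE; do !case: eqP.
  - exists (f (f a)); first by rewrite E.
    by rewrite t_eq !f3; apply/setP=> x; rewrite !inE; do !case: eqP.
have face_rot c c' : dtail c = u -> dtail c' = u -> dhead c' <> u ->
    dhead c <> dhead c' ->
    dhead c' \in [set dtail c; dtail (f c); dtail (f (f c))] -> c = R c'.
  move=> cu c'u c'h ne; rewrite !inE dtail_face cu => /orP[/orP[]|] /eqP E //.
    by case: ne.
  suff Ec : drev c' = f (f c) by rewrite rot_face Ec f3.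
  by apply: dart_inj; rewrite ?dtail_rev ?dhead_rev ?(dhead_face2 f3) ?cu.
have hu c : dtail c = u -> dhead c <> u by move=> <- /esym/dart_irrefl.
have ne : dhead d <> dhead d' by move=> E; move: dd'; rewrite E adj_irrefl.
have : dhead b \in [set u; dhead d; dhead d'].
  by rewrite t_eqb !inE dtail_face eqxx orbT.
rewrite !inE => /orP[/orP[]|] /eqP E.
- by case: (hu b bu).
- have Eb : b = d by apply: dart_inj => //; rewrite bu.
  right; apply: face_rot => //; first exact: hu.
  by rewrite -Eb -t_eqb !inE eqxx !orbT.
- have Eb : b = d' by apply: dart_inj => //; rewrite bu.
  left; apply: face_rot => //; [exact: hu | exact: nesym|].
  by rewrite -Eb -t_eqb !inE eqxx !orbT.
Qed.

End InnermostTriangle.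

(** * Even holes in triangulations without vertices of degree three *)

Lemma even_hole4 (N : sgraph) (x1 x2 x3 x4 : N) :
  adj x1 x2 -> adj x2 x3 -> adj x3 x4 -> adj x4 x1 ->
  ~~ adj x1 x3 -> ~~ adj x2 x4 -> x1 <> x3 -> x2 <> x4 ->
  even_hole [set x1; x2; x3; x4].
Proof.
move=> a12 a23 a34 a41 /negPf n13 /negPf n24 d13 d24.
have ne (x y : N) : adj x y -> x <> y by move=> xy E; rewrite E adj_irrefl in xy.
have [[[d12 d23] d34] d41] := (ne _ _ a12, ne _ _ a23, ne _ _ a34, ne _ _ a41).
pose col y := (y == x1) || (y == x3).
have WP x : x \in [set x1; x2; x3; x4] -> [\/ x = x1, x = x2, x = x3 | x = x4].
  by rewrite !inE => /orP[/orP[/orP[]|]|] /eqP ->;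
    [constructor 1|constructor 2|constructor 3|constructor 4].
have [c1 c2 c3 c4] : [/\ col x1, ~~ col x2, col x3 & ~~ col x4].
  by rewrite /col !eqxx orbT; split=> //; apply/norP; split; apply/eqP; congruence.
have adjE x y : x \in [set x1; x2; x3; x4] -> y \in [set x1; x2; x3; x4] ->
    adj x y = (col x != col y).
  move: c1 (negPf c2) c3 (negPf c4) => e1 e2 e3 e4.
  by case/WP=> ->; case/WP=> ->; rewrite ?e1 ?e2 ?e3 ?e4 ?adj_irrefl //;
    rewrite ?(a12, a23, a34, a41, n13, n24) // adj_sym ?(a12, a23, a34, a41, n13, n24).
split; first by exists x1; rewrite !inE eqxx.
  move=> x xW.
  have -> : [set y in [set x1; x2; x3; x4] | adj x y] =
      if col x then [set x2; x4] else [set x1; x3].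
    apply/setP=> y; rewrite inE; apply/andP/idP => [[yW]|].
      rewrite (adjE x y xW yW).
      by case/WP: yW => ->; rewrite ?c1 ?(negPf c2) ?c3 ?(negPf c4);
        case: (col x); rewrite // !inE eqxx ?orbT.
    have in24 : y \in [set x2; x4] -> y \in [set x1; x2; x3; x4] /\ ~~ col y.
      by rewrite !inE => /orP[] /eqP ->; rewrite ?eqxx ?orbT.
    have in13 : y \in [set x1; x3] -> y \in [set x1; x2; x3; x4] /\ col y.
      by rewrite !inE => /orP[] /eqP ->; rewrite ?eqxx ?orbT.
    case cx: (col x); [move/in24 | move/in13]; case=> yW cy; split=> //;
      by rewrite (adjE x y xW yW) cx ?cy // eq_sym; case: (col y) cy.
  by case: (col x); rewrite cards2; case: eqP.
exists col => x y xW yW; rewrite (adjE x y xW yW).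
by case: (col x); case: (col y).
Qed.

Section Wheels.
Variables (N : sgraph) (R : rotation N).
Hypothesis f3 : triangular R.
Local Notation f := (face_perm R).

Lemma adj_rot d : adj (dhead d) (dhead (R d)).
Proof.
have := dart_adj (f (f (drev d))).
by rewrite (dtail_face R (f _)) (dhead_face2 f3) -rot_face dtail_rev adj_sym.
Qed.

(** Either hypothesis makes the common neighbour the third vertex of one of the two
    faces at the edge of [d]; that face has its other corner at [dhead d]. *)
Lemma rot_common d a b :
  dtail a = dtail d -> dtail b = dhead d -> dhead a = dhead b ->
  (a = R d -> R b = drev d) /\ (R a = d -> b = R (drev d)).
Proof.
move=> da db ab; split=> E.
  have Eb : drev b = f (f (drev d)).
    apply: dart_inj; rewrite ?dtail_rev ?dhead_rev ?(dhead_face2 f3) //.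
    by rewrite (dtail_face R (f _)) -ab E rot_face.
  by rewrite rot_face Eb f3.
rewrite rot_face drevK; apply: dart_inj; first by rewrite dtail_face.
by rewrite -ab -E rot_face (dhead_face2 f3).
Qed.

Lemma wheel_common d a b : wheel R (dtail d) ->
  dtail a = dtail d -> dtail b = dhead d -> dhead a = dhead b ->
  (a = R d /\ R b = drev d) \/ (R a = d /\ b = R (drev d)).
Proof.
move=> wh da db ab; have [r1 r2] := rot_common da db ab.
have : adj (dhead d) (dhead a) by rewrite ab -db dart_adj.
by case/(wh _ _ erefl da) => E; [left | right]; split=> //; [exact: r1 | exact: r2].
Qed.

Hypothesis r3_neq : forall d, R (R (R d)) <> d.
Hypotheses (N_conn : connected N) (N_gt3 : 3 < #|N|).

(** If [d] and [R d] are the only darts at their tail, then the ends of these two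
    darts have degree two as well, and [N] is a triangle. *)
Lemma rot2_neq d : R (R d) <> d.
Proof.
move=> r2.
have two a b : R a = b -> R b = a -> forall c, dtail c = dtail a -> c = a \/ c = b.
  move=> ab ba c /esym/(rot_iter R)[n ->]; elim: n => [|n]; first by left.
  by rewrite iterS => -[] ->; [right | left].
have e1 : R (drev d) = f d by rewrite rot_face drevK.
have e2 : R (drev (R d)) = f (R d) by rewrite rot_face drevK.
have e3 : f (f (R d)) = drev d by rewrite rot_face f3.
have e4 : f (f d) = drev (R d) by rewrite -{1}r2 rot_face f3.
have e5 : drev (f d) = f (R d).
  apply: dart_inj; rewrite ?dtail_rev ?dhead_rev ?dtail_face.
    by rewrite -(dtail_face R (f d)) e4.
  by rewrite -(dtail_face R (f (R d))) e3.
have e6 : R (f d) = drev d by rewrite rot_face e5 e3.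
have e7 : R (f (R d)) = drev (R d) by rewrite rot_face -e5 drevK e4.
pose V := [set dtail d; dhead d; dhead (R d)].
have hf : dhead (f d) = dhead (R d) by rewrite -(dtail_face R (f d)) e4.
have hfR : dhead (f (R d)) = dhead d by rewrite -(dtail_face R (f (R d))) e3.
have V_adj x y : adj x y -> x \in V -> y \in V.
  case/dart_of=> c <- <-; rewrite !inE => /orP[/orP[]|] /eqP E.
  - by have [->|->] := two _ _ erefl r2 c E; rewrite eqxx ?orbT.
  - by have [->|->] := two _ _ e1 e6 c E; rewrite ?dhead_rev ?hf eqxx ?orbT.
  - by have [->|->] := two _ _ e2 e7 c E; rewrite ?dhead_rev ?rot_tail ?hfR eqxx ?orbT.
have V_all x : x \in V.
  have -> : (x \in V) = (dtail d \in V); last by rewrite !inE eqxx.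
  apply: (N_conn (t := fun x => x \in V)) => a b ab.
  by apply/idP/idP; apply: V_adj; rewrite // adj_sym.
have : #|N| <= #|V| by apply: subset_leq_card; apply/subsetP=> x _.
rewrite /V cards3.
- by move: N_gt3; lia.
- exact: dart_irrefl.
- by rewrite -(rot_tail R d); apply: dart_irrefl.
- by rewrite -hf -(dtail_face R d); apply: dart_irrefl.
Qed.

Lemma degree_ge4 d : 3 < #|porbit R d|.
Proof.
have := card_porbit_neq0 R d; have := iter_porbit R d.
case: #|_| => [|[|[|[|n]]]] //= E _.
- by case: (rot_neq f3 E).
- by case: (rot2_neq E).
- by case: (r3_neq E).
Qed.

Definition rot_index d0 d := index d (traject R d0 #|porbit R d0|).

Lemma rot_index_lt d0 d : dtail d = dtail d0 -> rot_index d0 d < #|porbit R d0|.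
Proof.
move=> E; rewrite -(size_traject R d0 #|porbit R d0|) index_mem.
by rewrite -porbit_traject rot_porbit E.
Qed.

Lemma rot_indexK d0 d : dtail d = dtail d0 -> iter (rot_index d0 d) R d0 = d.
Proof.
move=> E; rewrite -[RHS](nth_index d0 (s := traject R d0 #|porbit R d0|)); last first.
  by rewrite -porbit_traject rot_porbit E.
by rewrite (nth_traject R (rot_index_lt E)).
Qed.

Lemma rot_index_iter d0 n : n < #|porbit R d0| -> rot_index d0 (iter n R d0) = n.
Proof.
move=> n_lt; rewrite /rot_index -(nth_traject R n_lt).
by rewrite index_uniq ?size_traject ?uniq_traject_porbit.
Qed.

Lemma rot_index_next d0 d : dtail d = dtail d0 -> R d <> d0 ->
  rot_index d0 (R d) = (rot_index d0 d).+1.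
Proof.
move=> E ne; have lt := rot_index_lt E; have dE := rot_indexK E.
rewrite -[in LHS]dE -iterS rot_index_iter // ltn_neqAle lt andbT.
by apply/negP=> /eqP k; apply: ne; rewrite -[d]dE -iterS k iter_porbit.
Qed.

Lemma rot_index_last d0 d : dtail d = dtail d0 -> R d = d0 ->
  (rot_index d0 d).+1 = #|porbit R d0|.
Proof.
move=> E ne; have lt := rot_index_lt E; have dE := rot_indexK E.
apply/eqP; rewrite eqn_leq lt leqNgt; apply/negP=> lt'.
have := rot_index_iter lt'; rewrite iterS dE ne.
by have := rot_index_iter (d0 := d0) (n := 0); rewrite /= => -> //; apply: leq_ltn_trans lt.
Qed.

Lemma rot_index0 d0 : rot_index d0 d0 = 0.
Proof. by apply: (@rot_index_iter d0 0); have := degree_ge4 d0; lia. Qed.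

(** Positions in a rotation belong to darts, but holes are coloured at vertices. *)
Definition at_head (u : N) (F : dart N -> bool) (y : N) :=
  [exists d, [&& dtail d == u, dhead d == y & F d]].

Lemma at_headE F d : at_head (dtail d) F (dhead d) = F d.
Proof.
apply/existsP/idP => [[d' /and3P[/eqP t /eqP h Fd']]|Fd].
  by rewrite (dart_inj (d := d) (d' := d')).
by exists d; rewrite !eqxx.
Qed.

(** A common neighbour of [u] and [dhead d] spans a face with them, so its edge is
    next to [d] in the rotation at [u]. *)
Lemma wheel_neighbours u d c : wheel R u -> dtail c = u -> R c = d ->
  [set y | adj u y && adj (dhead d) y] = [set dhead (R d); dhead c].
Proof.
move=> wh cu cd; have du : dtail d = u by rewrite -cd rot_tail.
apply/setP=> y; rewrite !inE; apply/andP/idP => [[/dart_of[a au <-]]|].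
  by case/(wh _ _ du au) => E; rewrite ?E ?eqxx //; move: cd; rewrite E => /perm_inj ->;
    rewrite eqxx orbT.
case/orP=> /eqP ->; split.
- by rewrite -du -(rot_tail R d) dart_adj.
- exact: adj_rot.
- by rewrite -cu dart_adj.
- by rewrite adj_sym -cd adj_rot.
Qed.

Lemma rot_prev d : exists2 c, R c = d & dtail c = dtail d.
Proof.
exists ((R : {perm dart N})^-1 d)%g; first by rewrite permKV.
by rewrite -[LHS](rot_tail R) permKV.
Qed.

Lemma dhead_neq (d d' : dart N) : dtail d = dtail d' -> d <> d' -> dhead d <> dhead d'.
Proof. by move=> t ne h; apply: ne; apply: dart_inj. Qed.

(** The neighbours of [dtail d0] form a chordless cycle in the order of the
    rotation, and the parity of the position colours it. *)
Lemma even_link d0 : wheel R (dtail d0) -> ~~ odd #|porbit R d0| ->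
  even_hole [set y | adj (dtail d0) y].
Proof.
move=> wh k_even; split.
- by exists (dhead d0); rewrite inE dart_adj.
- move=> x; rewrite inE => /dart_of[d du <-]; have [c cd cu] := rot_prev d.
  rewrite du in cu; have := wheel_neighbours wh cu cd.
  rewrite (_ : [set y | _] = [set y in [set y | adj (dtail d0) y] | adj (dhead d) y]).
    move=> ->; rewrite cards2; case: eqP => // /dhead_neq; case.
      by rewrite rot_tail du.
    by rewrite -cd; apply: rot2_neq.
  by apply/setP=> y; rewrite !inE.
exists (at_head (dtail d0) (fun d => odd (rot_index d0 d))) => x y.
rewrite !inE => /dart_of[d du <-] /dart_of[d' d'u <-] dd'.
have [E E'] : at_head (dtail d0) (fun a => odd (rot_index d0 a)) (dhead d) =
      odd (rot_index d0 d) /\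
    at_head (dtail d0) (fun a => odd (rot_index d0 a)) (dhead d') =
      odd (rot_index d0 d').
  by split; [rewrite -{1}du | rewrite -{1}d'u]; rewrite at_headE.
rewrite {}E {}E'.
have flip a : dtail a = dtail d0 -> odd (rot_index d0 (R a)) = ~~ odd (rot_index d0 a).
  move=> au; have [E|ne] := eqVneq (R a) d0; last by rewrite rot_index_next //; apply/eqP.
  have := rot_index_last au E; rewrite E rot_index0 => k.
  by move: k_even; rewrite -k /= negbK => ->.
case: (wh _ _ du d'u dd') => ->; first by rewrite flip // negbK.
by rewrite flip.
Qed.

(** If all triangles at the ends of [d] are faces, these are the vertices of the cycle
    that bounds the union of the faces at these ends. *)
Definition edge_link (d : dart N) := [set y | [&& adj (dtail d) y || adj (dhead d) y,
  y != dtail d & y != dhead d]].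

Lemma edge_link_rev d : edge_link (drev d) = edge_link d.
Proof. by apply/setP=> y; rewrite !inE orbC [X in _ && X]andbC. Qed.

Definition no_cross_edge (d : dart N) := forall a b : N,
  adj (dtail d) a -> ~~ adj (dhead d) a -> a != dhead d ->
  adj (dhead d) b -> ~~ adj (dtail d) b -> b != dtail d -> ~~ adj a b.

Lemma no_cross_edge_rev d : no_cross_edge d -> no_cross_edge (drev d).
Proof. by move=> nc a b h1 h2 h3 h4 h5 h6; rewrite adj_sym; apply: nc. Qed.

Section EdgeLink.
Variable d0 : dart N.
Hypotheses (wh : wheel R (dtail d0)) (wh' : wheel R (dhead d0)).
Hypothesis no_cross : no_cross_edge d0.

Let edge_link_degree1 x : x \in edge_link d0 -> adj (dtail d0) x ->
  ~~ adj (dhead d0) x -> #|[set y in edge_link d0 | adj x y]| = 2.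
Proof.
rewrite inE => /and3P[_ xu xv] /dart_of[d du dx] vx.
have [c cd cu] := rot_prev d; rewrite du in cu.
have := wheel_neighbours wh cu cd; rewrite dx => nbr.
have -> : [set y in edge_link d0 | adj x y] = [set y | adj (dtail d0) y && adj x y].
  apply/setP=> y; rewrite !inE; apply/andP/andP=> -[h1 h2]; split=> //.
    case/and3P: h1 => /orP[//|vy yu yv]; apply/negPn/negP=> uy.
    have ux : adj (dtail d0) x by rewrite -du -dx dart_adj.
    by have := no_cross ux vx xv vy uy yu; rewrite h2.
  rewrite h1 /=; apply/andP; split.
    by apply: contraTneq h1 => ->; rewrite adj_irrefl.
  by apply: contraTneq h2 => ->; rewrite adj_sym.
rewrite nbr cards2; case: eqP => // /dhead_neq; case; first by rewrite rot_tail cu.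
by rewrite -cd; apply: rot2_neq.
Qed.

Lemma edge_link_degree2 x d : dtail d = dtail d0 -> dhead d = x -> adj (dhead d0) x ->
  d = R d0 -> #|[set y in edge_link d0 | adj x y]| = 2.
Proof.
move=> du dx /dart_of[e ev ex] dE.
have [r1 _] := rot_common du ev (etrans dx (esym ex)).
have eE := r1 dE; have [c ce cv] := rot_prev e; rewrite ev in cv.
have nbr_u := wheel_neighbours wh (erefl _) (esym dE).
have nbr_v := wheel_neighbours wh' cv ce.
have -> : [set y in edge_link d0 | adj x y] = [set dhead (R d); dhead c].
  have in_u y : (y \in [set dhead (R d); dhead d0]) = adj (dtail d0) y && adj x y.
    by rewrite -nbr_u inE dx.
  have in_v y : (y \in [set dhead (R e); dhead c]) = adj (dhead d0) y && adj x y.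
    by rewrite -nbr_v inE ex.
  have n1 : dhead (R d) != dtail d0.
    by apply/eqP=> E; apply: (dart_irrefl (R d)); rewrite E rot_tail.
  have n2 : dhead (R d) != dhead d0.
    apply/eqP=> E; suff : R d = d0 by rewrite dE; apply: rot2_neq.
    by apply: dart_inj; rewrite ?rot_tail.
  have n3 : dhead c != dhead d0.
    by apply/eqP=> E; apply: (dart_irrefl c); rewrite cv E.
  have n4 : dhead c != dtail d0.
    apply/eqP=> E; suff Ec : c = drev d0.
      by apply: (@rot2_neq c); rewrite ce eE Ec.
    exact: dart_inj.
  apply/setP=> y; rewrite inE [y \in edge_link d0]inE.
  have -> : [&& adj (dtail d0) y || adj (dhead d0) y, y != dtail d0
      & y != dhead d0] && adj x y =
    (adj (dtail d0) y && adj x y || adj (dhead d0) y && adj x y) &&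
      ((y != dtail d0) && (y != dhead d0)).
    by case: (adj x y); rewrite ?andbT ?andbF.
  rewrite -in_u -in_v eE dhead_rev !inE.
  have [->|] := eqVneq y (dhead (R d)); first by rewrite n1 n2.
  have [->|] := eqVneq y (dhead c); first by rewrite n3 n4 !orbT.
  by case: (y == dhead d0); case: (y == dtail d0).
rewrite cards2; case: eqP => // E.
have := wheel_common wh (a := R d) (b := c); rewrite rot_tail.
case/(_ du cv E) => -[h _].
  by case: (rot_neq f3 (d := d0)); rewrite -dE; apply: perm_inj h.
by case: (r3_neq (d := d0)); rewrite -dE.
Qed.

(** In the second case [x] is the common neighbour of the ends that follows
    [drev d0]; there [edge_link_degree2] applies to [drev d0] instead of [d0]. *)
Lemma edge_link_cases x : x \in edge_link d0 -> adj (dtail d0) x ->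
  #|[set y in edge_link d0 | adj x y]| = 2 \/
  exists2 b, dhead b = x & dtail b = dhead d0 /\ b = R (drev d0).
Proof.
move=> xW ux; case vx: (adj (dhead d0) x); last first.
  by left; apply: edge_link_degree1; rewrite ?vx.
have [[d du dx] [b bv bx]] := (dart_of ux, dart_of vx).
case: (wheel_common wh du bv (etrans dx (esym bx))) => -[E E'].
  by left; apply: edge_link_degree2 du dx vx E.
by right; exists b.
Qed.

Hypotheses (k_odd : odd #|porbit R d0|) (k'_odd : odd #|porbit R (drev d0)|).

(** The parities of the positions alternate on the part of the cycle around either
    end.  At the two common neighbours of the ends the positions are 1 and the even
    number one below the degree, in opposite orders for the two ends; so negating
    the parities at one end makes the two colourings agree. *)
Let colour x := if adj (dtail d0) x
  then at_head (dtail d0) (fun d => odd (rot_index d0 d)) x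
  else at_head (dhead d0) (fun d => ~~ odd (rot_index (drev d0) d)) x.

Let colour_tail d : dtail d = dtail d0 ->
  colour (dhead d) = odd (rot_index d0 d).
Proof. by move=> du; rewrite /colour -{1 2}du dart_adj at_headE. Qed.

Let colour_head d : dtail d = dhead d0 -> dhead d != dtail d0 ->
  colour (dhead d) = ~~ odd (rot_index (drev d0) d).
Proof.
move=> dv ne; rewrite /colour; case: ifP => [|_]; last by rewrite -dv at_headE.
case/dart_of=> a au ad; rewrite -ad -{1}au at_headE.
have k_gt := degree_ge4 d0; have k'_gt := degree_ge4 (drev d0).
case: (wheel_common wh au dv ad) => -[E E'].
  rewrite E rot_index_next ?rot_index0 //; last exact: (rot_neq f3).
  by have := rot_index_last (d0 := drev d0) dv E'; move: k'_odd => /[swap] <- /=.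
rewrite E' rot_index_next ?rot_index0 //; last exact: (rot_neq f3).
by have := rot_index_last au E; move: k_odd => /[swap] <- /= /negbTE.
Qed.

Let colour_edge x y : x \in edge_link d0 -> y \in edge_link d0 -> adj x y ->
  colour x = ~~ colour y.
Proof.
rewrite !inE => /and3P[xW xu xv] /and3P[yW yu yv] xy.
case ux: (adj (dtail d0) x) xW => /= xW; case uy: (adj (dtail d0) y) yW => /= yW.
- have [[a au ax] [b bu bY]] := (dart_of ux, dart_of uy).
  rewrite -ax -bY !colour_tail //.
  have := wh au bu; rewrite ax bY => /(_ xy)[] E; rewrite E rot_index_next /= ?negbK //.
    by move=> E'; case/eqP: yv; rewrite -bY E E'.
  by move=> E'; case/eqP: xv; rewrite -ax E E'.
- case vx: (adj (dhead d0) x); last first.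
    by have := no_cross ux (negbT vx) xv yW (negbT uy) yu; rewrite xy.
  have [[a au ax] [b bu bY]] := (dart_of vx, dart_of yW).
  rewrite -ax -bY !colour_head ?ax ?bY //.
  have := wh' au bu; rewrite ax bY => /(_ xy)[] E; rewrite E rot_index_next /= ?negbK //.
    by move=> E'; case/eqP: yu; rewrite -bY E E'.
  by move=> E'; case/eqP: xu; rewrite -ax E E'.
- case vy: (adj (dhead d0) y); last first.
    have := no_cross uy (negbT vy) yv xW (negbT ux) xu.
    by rewrite adj_sym xy.
  have [[a au ax] [b bu bY]] := (dart_of xW, dart_of vy).
  rewrite -ax -bY !colour_head ?ax ?bY //.
  have := wh' au bu; rewrite ax bY => /(_ xy)[] E; rewrite E rot_index_next /= ?negbK //.
    by move=> E'; case/eqP: yu; rewrite -bY E E'.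
  by move=> E'; case/eqP: xu; rewrite -ax E E'.
have [[a au ax] [b bu bY]] := (dart_of xW, dart_of yW).
rewrite -ax -bY !colour_head ?ax ?bY //.
have := wh' au bu; rewrite ax bY => /(_ xy)[] E; rewrite E rot_index_next /= ?negbK //.
  by move=> E'; case/eqP: yu; rewrite -bY E E'.
by move=> E'; case/eqP: xu; rewrite -ax E E'.
Qed.

Lemma edge_link_colour : exists col : N -> bool, forall x y,
  x \in edge_link d0 -> y \in edge_link d0 -> adj x y -> col x = ~~ col y.
Proof. exists colour; exact: colour_edge. Qed.

End EdgeLink.

Lemma edge_link_even_hole d0 : wheel R (dtail d0) -> wheel R (dhead d0) ->
  no_cross_edge d0 -> odd #|porbit R d0| -> odd #|porbit R (drev d0)| ->
  even_hole (edge_link d0).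
Proof.
move=> wh wh' nc k_odd k'_odd; split; last exact: edge_link_colour.
  exists (dhead (R d0)); rewrite inE -{1}(rot_tail R d0) dart_adj /=.
  apply/andP; split; apply/eqP.
    by rewrite -(rot_tail R d0); apply/nesym/dart_irrefl.
  apply: dhead_neq; [exact: rot_tail | exact: (rot_neq f3)].
move=> x xW; have : adj (dtail d0) x || adj (dhead d0) x.
  by move: xW; rewrite inE => /and3P[].
have rev_cases := edge_link_cases (d0 := drev d0) wh' wh (no_cross_edge_rev nc).
rewrite edge_link_rev in rev_cases; case/orP=> x_adj.
  case: (edge_link_cases wh wh' nc xW x_adj) => // -[b bx [bv bE]].
  have vx : adj (dtail (drev d0)) x by rewrite dtail_rev -bv -bx dart_adj.
  rewrite -edge_link_rev in xW *.
  by apply: (edge_link_degree2 (d0 := drev d0) wh' wh bv bx x_adj bE).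
case: (rev_cases x xW x_adj) => // -[b bx [bv bE]]; rewrite drevK in bE.
have ux : adj (dtail d0) x by rewrite -dhead_rev -bv -bx dart_adj.
by apply: (edge_link_degree2 wh wh' bv bx x_adj bE).
Qed.

End Wheels.

(** Inside an innermost triangle there are two adjacent vertices all of whose
    triangles are faces.  If one of them has even degree, its link is an even hole.
    If both degrees are odd, then the link of their edge has even length, and it is
    an even hole unless it has a chord; a chord closes a chordless cycle of length
    four with the edge. *)
Lemma degree3_or_even_hole (N : sgraph) (R : rotation N) :
  triangular R -> connected N -> 3 < #|N| -> has_genus R 0 ->
  (forall d, R (R (R d)) <> d) -> exists W : {set N}, even_hole W.
Proof.
move=> f3 N_conn N_gt3 N_sphere r3.
have [t [s [tt st /set0Pn[u uI] t_face]]] := innermost_triangle f3 N_conn N_gt3 N_sphere.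
have wheelI v : v \in interior s t -> wheel R v.
  by move=> vI; apply: facial_wheel => // t' tt' vt'; apply: t_face vI.
have [d0 d0u] := connected_dart u N_conn (ltn_trans (isT : 1 < 3) N_gt3).
have [d du dt] : exists2 d, dtail d = u & dhead d \notin t.
  case: (pickP (fun d => (dtail d == u) && (dhead d \notin t))) => [d /andP[/eqP ? ?]|none].
    by exists d.
  have := degree_ge4 f3 r3 N_conn N_gt3 d0.
  rewrite -(card_in_imset (f := @dhead N)) => [|a b]; last first.
    by rewrite !rot_porbit => /eqP ta /eqP tb; apply: dart_inj; rewrite -ta -tb.
  rewrite ltnNge -[X in _ <= X](eqP (andP tt).1) subset_leq_card //.
  apply/subsetP=> y /imsetP[a]; rewrite rot_porbit => /eqP ta ->.
  by apply/negPn; have := none a; rewrite -ta d0u eqxx => /= ->.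
have wh : wheel R (dtail d) by apply: wheelI; rewrite du.
have wh' : wheel R (dhead d).
  by apply/wheelI/(interior_adj st uI _ dt); rewrite -du dart_adj.
case: (boolP (odd #|porbit R d|)) => k_odd; last first.
  by exists [set y | adj (dtail d) y]; apply: even_link.
case: (boolP (odd #|porbit R (drev d)|)) => k'_odd; last first.
  by exists [set y | adj (dtail (drev d)) y]; apply: even_link.
pose cross (p : N * N) := [&& adj (dtail d) p.1, ~~ adj (dhead d) p.1, p.1 != dhead d,
  adj (dhead d) p.2, ~~ adj (dtail d) p.2 & (p.2 != dtail d) && adj p.1 p.2].
case: (pickP cross) => [[a b]|none].
  case/and5P=> /= ua va av vb /and3P[ub bu ab].
  exists [set dtail d; a; b; dhead d]; apply: even_hole4 => //.
  - by rewrite adj_sym.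
  - by rewrite adj_sym dart_adj.
  - by rewrite adj_sym.
  - by apply/eqP; rewrite eq_sym.
  - exact/eqP.
exists (edge_link d); apply: edge_link_even_hole => //.
move=> a b ua va av vb ub bu; apply/negP=> ab.
by have := none (a, b); rewrite /cross /= ua va av vb ub bu ab.
Qed.

(** * Removing a vertex of degree three *)

Section Delete.
Variables (N : sgraph) (v : N).

Definition delete : sgraph :=
  @SGraph {x : N | x != v} (fun x y => adj (val x) (val y))
    (fun x y => adj_sym (val x) (val y)) (fun x => adj_irrefl (val x)).

Definition undelete_dart (d : dart delete) : dart N :=
  exist (fun p : N * N => adj p.1 p.2) (val (dtail d), val (dhead d)) (dart_adj d).

Local Notation old d := ((dtail d != v) && (dhead d != v)).

Definition delete_dart (d : dart N) (d_old : old d) : dart delete :=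
  exist (fun p : delete * delete => adj p.1 p.2)
    (exist _ (dtail d) (andP d_old).1, exist _ (dhead d) (andP d_old).2)
    (dart_adj d).

Lemma delete_dartK d d_old : undelete_dart (@delete_dart d d_old) = d.
Proof. exact: dart_inj. Qed.

Lemma undelete_inj : injective undelete_dart.
Proof.
move=> d d' E; apply: dart_inj; apply: val_inj.
  exact: (congr1 (@dtail N) E).
exact: (congr1 (@dhead N) E).
Qed.

Lemma undelete_old d : old (undelete_dart d).
Proof. by apply/andP; split; [apply: (valP (dtail d)) | apply: (valP (dhead d))]. Qed.

Lemma undelete_rev d : undelete_dart (drev d) = drev (undelete_dart d).
Proof. exact: dart_inj. Qed.

Variable R : rotation N.
Hypothesis f3 : triangular R.
Local Notation f := (face_perm R).

Let skip d := if dhead (R d) == v then R (R d) else R d.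

Let skip_tail d : dtail (skip d) = dtail d.
Proof. by rewrite /skip; case: ifP; rewrite !rot_tail. Qed.

Let head_rot_neq d : dhead (R d) <> dhead d.
Proof. by move=> E; apply: (rot_neq f3 (d := d)); apply: dart_inj; rewrite ?rot_tail. Qed.

Let skip_old d : old d -> old (skip d).
Proof.
case/andP=> t h; rewrite skip_tail t /skip; case: ifP => [/eqP hv|-> //].
by apply/eqP=> E; apply: (@head_rot_neq (R d)); rewrite E.
Qed.

Let del_rot d := delete_dart (skip_old (undelete_old d)).

Let del_rotE d : undelete_dart (del_rot d) = skip (undelete_dart d).
Proof. exact: delete_dartK. Qed.

Let del_rot_inj : injective del_rot.
Proof.
move=> d d' /(congr1 undelete_dart); rewrite !del_rotE => E; apply: undelete_inj.
have [/andP[_ h] /andP[_ h']] := (undelete_old d, undelete_old d').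
move: E; rewrite /skip; case: ifP => [/eqP hv|nv]; case: ifP => [/eqP hv'|nv'].
- by move/perm_inj/perm_inj.
- by move/perm_inj=> E; move: h'; rewrite -E hv eqxx.
- by move/perm_inj=> E; move: h; rewrite E hv' eqxx.
- by move/perm_inj.
Qed.

Let del_perm_tail d : dtail (perm del_rot_inj d) = dtail d.
Proof. by rewrite permE; apply: val_inj; apply: (skip_tail (undelete_dart d)). Qed.

Let del_perm_trans d d' : dtail d = dtail d' -> d' \in porbit (perm del_rot_inj) d.
Proof.
move=> E; have : dtail (undelete_dart d) = dtail (undelete_dart d').
  exact: (congr1 val E).
case/(rot_iter R)=> n; have [m] := ubnP n; elim: m => // m IH in n d {E} *.
rewrite ltnS; case: n => [|n] n_le.
  by move/undelete_inj->; apply: porbit_id.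
rewrite iterSr => d'E; have step : perm del_rot_inj d \in porbit (perm del_rot_inj) d.
  exact: porbit_stable.
case hv : (dhead (R (undelete_dart d)) == v); last first.
  apply: porbit_trans step _; apply: (IH n) => //.
  by rewrite permE del_rotE /skip hv.
case: n n_le d'E => [|n] n_le d'E.
  by have := undelete_old d'; rewrite d'E hv andbF.
apply: porbit_trans step _; apply: (IH n) => //; first exact: ltnW.
by rewrite permE del_rotE /skip hv -iterSr.
Qed.

Definition delete_rot : rotation delete := Rotation del_perm_tail del_perm_trans.

Lemma delete_face d : undelete_dart (face_perm delete_rot d) =
  let e := undelete_dart d in
  if dhead (f e) == v then f (drev (f e)) else f e.
Proof.
rewrite face_permE /= permE del_rotE /skip undelete_rev -!face_permE.
by case: ifP => // _; rewrite rot_face.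
Qed.

Variable y : dart N.
Hypotheses (yv : dtail y = v) (r3 : R (R (R y)) = y).

Let at_v d : dtail d = v -> [\/ d = y, d = R y | d = R (R y)].
Proof.
rewrite -yv => /esym/(rot_iter R)[n ->]; elim: n => [|n]; first by constructor 1.
by rewrite iterS => -[] ->; rewrite ?r3; [constructor 2|constructor 3|constructor 1].
Qed.

Let r3v d : dtail d = v -> R (R (R d)) = d.
Proof. by case/at_v=> ->; rewrite !r3. Qed.

Let f2R d : f (f (R d)) = drev d. Proof. by rewrite rot_face f3. Qed.

Let face_into_v e : dhead (f e) = v -> exists2 x, dtail x = v & f e = drev x /\ e = f (R x).
Proof.
move=> h; exists (drev (f e)) => //; rewrite drevK; split=> //.
by apply: (@perm_inj _ f); rewrite f2R drevK.
Qed.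

Let head_fR x : dhead (f (R x)) = dhead x.
Proof. by rewrite -(dtail_face R (f _)) f2R. Qed.

Let face_v x : dtail x = v -> dhead (f (f x)) = v.
Proof. by move=> xv; rewrite (dhead_face2 f3). Qed.

Lemma delete_triangular : triangular delete_rot.
Proof.
pose F e := if dhead (f e) == v then f (drev (f e)) else f e.
have FE d : undelete_dart (face_perm delete_rot d) = F (undelete_dart d).
  exact: delete_face.
move=> d; apply: undelete_inj; rewrite !FE.
set e := undelete_dart d; have /andP[te he] : old e := undelete_old d.
have Fv x : dtail x = v -> F (f x) = f (R (R x)).
  by move=> xv; rewrite /F (face_v xv) eqxx -{1}(r3v xv) f2R drevK.
case: (eqVneq (dhead (f e)) v) => [h|ne].
  have [x xv [fe eE]] := face_into_v h.
  have -> : F e = f x by rewrite /F h eqxx fe drevK.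
  by rewrite !Fv ?rot_tail // r3v ?rot_tail // -eE.
have Fe : F e = f e by rewrite /F (negPf ne).
have Ffe : F (f e) = f (f e) by rewrite /F (dhead_face2 f3) (negPf te).
by rewrite Fe Ffe /F f3 (negPf he).
Qed.

Lemma card_delete : #|N| = #|delete| + 1.
Proof.
rewrite card_sig (cardD1 v) inE addnC; congr (_ + 1).
by apply: eq_card => x; rewrite !inE andbT.
Qed.

Lemma card_dart_delete : #|dart N| = #|dart delete| + 6.
Proof.
rewrite -cardsT -(cardsID (undelete_dart @: [set: dart delete])) setTI.
rewrite card_imset ?cardsT; last exact: undelete_inj.
congr (_ + _).
pose S := [set y; R y; R (R y)].
have SP d : (d \in S) = (dtail d == v).
  rewrite !inE; apply/idP/eqP => [|/at_v[] ->]; rewrite ?eqxx ?orbT //.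
  by case/orP=> [/orP[]|] /eqP ->; rewrite ?rot_tail.
have S3 : #|S| = 3.
  apply: cards3 => E; [apply: (rot_neq f3 (d := y)) | |apply: (rot_neq f3 (d := R y))] => //.
  by apply: (rot_neq f3 (d := y)); rewrite {1}E r3.
have -> : [set: dart N] :\: undelete_dart @: [set: dart delete] = S :|: @drev N @: S.
  apply/setP=> d; rewrite in_setD in_setT andbT in_setU SP.
  have -> : (d \in @drev N @: S) = (dhead d == v).
    rewrite -[d in LHS]drevK mem_imset; last exact: can_inj (@drevK N).
    by rewrite SP.
  apply/idP/idP => [|nv].
    apply: contraR; rewrite negb_or => d_old; apply/imsetP.
    by exists (delete_dart d_old); rewrite ?delete_dartK.
  apply/imsetP=> -[d' _ E]; have := undelete_old d'; rewrite -E.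
  by case/orP: nv => ->; rewrite ?andbF.
rewrite cardsU card_imset ?S3; last exact: can_inj (@drevK N).
rewrite (_ : _ :&: _ = set0) ?cards0 //; apply/setP=> d; rewrite in_setI in_set0 SP.
apply/negbTE/negP=> /andP[/eqP dv /imsetP[d']]; rewrite SP => /eqP d'v E.
by apply: (dart_irrefl d'); rewrite d'v -dv E.
Qed.

Let head_v x : dtail x = v -> dhead x != v.
Proof. by move=> <-; apply/eqP/nesym/dart_irrefl. Qed.

Definition nbr x (xv : dtail x = v) : delete := exist _ (dhead x) (head_v xv).

Let yv1 : dtail (R y) = v. Proof. by rewrite rot_tail. Qed.
Let yv2 : dtail (R (R y)) = v. Proof. by rewrite !rot_tail. Qed.
Local Notation a := (nbr yv).
Local Notation b := (nbr yv2).
Local Notation c := (nbr yv1).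

Lemma delete_connected : connected N -> connected delete.
Proof.
move=> N_conn t t_adj.
pose t' x := if insub x is Some x' then t x' else t a.
have t'E (x : delete) : t' (val x) = t x by rewrite /t' valK.
have t'v : t' v = t a by rewrite /t' insubF // eqxx.
have ac : t a = t c by apply: t_adj; apply: (adj_rot f3 y).
have cb : t c = t b by apply: t_adj; apply: (adj_rot f3 (R y)).
have t'_nbr d : dtail d = v -> t' (dhead d) = t a.
  by case/at_v=> ->; [rewrite -(t'E a) | rewrite ac -(t'E c) | rewrite ac cb -(t'E b)].
suff t'_const p q : t' p = t' q by move=> p q; rewrite -!t'E.
apply: N_conn => {}p {}q /dart_of[d <- <-].
have [tv|tv] := eqVneq (dtail d) v; first by rewrite tv t'v t'_nbr.
have [hv|hv] := eqVneq (dhead d) v.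
  by rewrite hv t'v -dhead_rev -(t'_nbr (drev d)).
pose u : delete := exist (fun x => x != v) _ tv.
pose w : delete := exist (fun x => x != v) _ hv.
by rewrite -[dtail d]/(val u) -[dhead d]/(val w) !t'E; apply/t_adj/dart_adj.
Qed.

Let face_of x : triangular_face R (dhead x) (dhead (f x)) (dtail x).
Proof.
split.
- by exists (f x); rewrite dtail_face (dhead_face2 f3).
- by exists (f (f x)); rewrite (dtail_face R (f x)) (dhead_face2 f3) f3.
- by exists x.
Qed.

Let old_face x p q (xv : dtail x = v) (pv : dtail p = v) (qv : dtail q = v) :
  p = R (R x) -> q = R x -> face_step delete_rot (nbr xv) (nbr pv) (nbr qv).
Proof.
move=> pE qE; have fxE : f x = f (R (R (R x))) by rewrite r3v.
have fx_old : old (f x).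
  by rewrite dtail_face head_v //= fxE head_fR head_v // !rot_tail.
exists (delete_dart fx_old); split; apply: val_inj.
- exact: (dtail_face R x).
- by rewrite /= pE -[RHS]head_fR -fxE.
rewrite -[LHS]/(dhead (undelete_dart (face_perm delete_rot _))) delete_face.
rewrite delete_dartK /= (face_v xv) eqxx.
by rewrite -{1}(r3v xv) f2R drevK head_fR qE.
Qed.

Definition undelete (o : option delete) : N := if o is Some x then val x else v.

Lemma delete_subdivision : face_subdivision delete_rot R a b c undelete.
Proof.
have y3 : [/\ y = R (R (R y)), R (R y) = R (R y) & R y = R (R (R (R y)))].
  by rewrite !r3.
have [e1 e2 e3] := y3.
split.
- by split; apply: old_face; rewrite ?r3.
- exists (fun x => insub x) => [[x|]|x] /=; first by rewrite valK.
    by rewrite insubF ?eqxx.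
  have [-> | xv] := eqVneq x v; first by rewrite insubF ?eqxx.
  by rewrite (insubT (fun x => x != v) xv).
- by [].
- move=> x; rewrite !inE; apply/idP/idP => [/dart_of[d dv /= dx]|].
    by case/at_v: dv dx => -> dx; rewrite -!(inj_eq val_inj) /= -dx ?eqxx ?orbT.
  have nbr_adj z : dtail z = v -> adj v (dhead z) by move=> <-; apply: dart_adj.
  by case/or3P=> /eqP ->; [apply: (nbr_adj y) | apply: (nbr_adj (R (R y)))
    | apply: (nbr_adj (R y))].
- have := face_of y; rewrite yv /=; suff -> : dhead (f y) = dhead (R (R y)) by [].
  by rewrite -[RHS]head_fR r3.
- have := face_of (R (R y)); rewrite yv2 /=.
  by suff -> : dhead (f (R (R y))) = dhead (R y) by []; rewrite -[RHS]head_fR.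
- have := face_of (R y); rewrite yv1 /=.
  by suff -> : dhead (f (R y)) = dhead y by []; rewrite -[RHS]head_fR.
move=> p q z pq [d [dp dq dz]]; exists (undelete_dart d); split.
- by rewrite -dp.
- by rewrite -dq.
rewrite -dz -[RHS]/(dhead (undelete_dart (face_perm delete_rot d))) delete_face /=.
case: ifP => // /eqP /face_into_v[x xv [_ dE]].
case/negP: pq; rewrite !inE !xpair_eqE -!(inj_eq val_inj) /= -dp -dq.
rewrite -[val (dtail d)]/(dtail (undelete_dart d)) -[val (dhead d)]/(dhead (undelete_dart d)).
rewrite dE head_fR dtail_face.
by case/at_v: xv => ->; rewrite ?r3 !eqxx ?orbT.
Qed.

Lemma delete_even_hole (W : {set delete}) : even_hole W -> even_hole (val @: W).
Proof.
case=> [[x xW] W_deg [col W_col]]; split.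
- by exists (val x); apply: imset_f.
- move=> _ /imsetP[w wW ->]; rewrite -(W_deg w wW) -(card_imset _ val_inj).
  apply: eq_card => z; rewrite inE; apply/andP/imsetP => [[/imsetP[u uW ->] wu]|[u]].
    by exists u; rewrite // inE uW.
  by rewrite inE => /andP[uW wu] ->; split=> //; apply: imset_f.
exists (fun z => if insub z is Some z' then col z' else false).
by move=> _ _ /imsetP[p pW ->] /imsetP[q qW ->] pq; rewrite !valK; apply: W_col.
Qed.

End Delete.

Lemma card4_complete (N : sgraph) : #|N| = 4 -> #|dart N| = 12 ->
  forall x y : N, adj x y = (x != y).
Proof.
move=> N4 D12; pose A := [set p : N * N | adj p.1 p.2].
pose B := [set p : N * N | p.1 != p.2].
have cardA : #|A| = 12.
  by rewrite -D12 card_sig; apply: eq_card => p; rewrite !inE.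
have cardB : #|B| = 12.
  have diag_inj : injective (fun x : N => (x, x)) by move=> x y [].
  have BE : B = ~: [set (x, x) | x in N].
    apply/setP=> -[x y]; rewrite !inE /=; congr (~~ _).
    by apply/eqP/imsetP => [->|[z _ [-> ->]] //]; exists y.
  have := cardsC [set (x, x) | x in N].
  by rewrite -BE (card_imset _ diag_inj) card_prod N4; lia.
have AB : A = B.
  apply/eqP; rewrite eqEcard cardA cardB leqnn andbT; apply/subsetP=> -[x y].
  by rewrite !inE /=; apply: contraTneq => ->; rewrite adj_irrefl.
by move=> x y; have /setP/(_ (x, y)) := AB; rewrite !inE.
Qed.

Lemma triangulation_genus0 (N : sgraph) (R : rotation N) :
  triangular R -> #|dart N| + 12 = #|N| * 6 -> has_genus R 0.
Proof.
by move/card_faces_triangular=> F3 cardN; apply/has_genus_darts; lia.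
Qed.

(** Vertices of degree three are removed until four vertices remain; an even hole of
    a smaller triangulation would be one of [N], as it is induced. *)
Lemma apollonian_of_no_even_hole (N : sgraph) (R : rotation N) :
  triangular R -> connected N -> #|dart N| + 12 = #|N| * 6 -> 3 < #|N| ->
  (forall W : {set N}, ~ even_hole W) -> apollonian_network R.
Proof.
have [n] := ubnP #|N|; elim: n N R => // n IH N R; rewrite ltnS => N_le.
move=> f3 N_conn cardN N_gt3 no_hole.
have N_sphere := triangulation_genus0 f3 cardN.
have [N4|N5] := eqVneq #|N| 4.
  by apply: apollonian_K4 N_sphere => //; apply: card4_complete => //; lia.
case: (pickP (fun d => R (R (R d)) == d)) => [y /eqP r3|none]; last first.
  have r3_neq d : R (R (R d)) <> d by move=> E; have := none d; rewrite E eqxx.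
  by have [W /no_hole] := degree3_or_even_hole f3 N_conn N_gt3 N_sphere r3_neq.
have card1 := card_delete (dtail y).
have card6 := card_dart_delete f3 (erefl _) r3.
apply: apollonian_subdiv (delete_subdivision f3 (erefl _) r3); apply: IH.
- by move: card1 N_le; lia.
- exact: delete_triangular (erefl _) r3.
- exact (delete_connected f3 (erefl (dtail y)) r3 N_conn).
- by move: card1 card6 cardN; lia.
- by move: card1 N5 N_gt3; lia.
by move=> W /delete_even_hole; apply: no_hole.
Qed.

(** * The dual of a 3-connected cubic planar graph *)

Section Dual.
Variables (G : sgraph) (R : rotation G).
Hypotheses (G_3conn : k_connected 3 G) (G_cubic : cubic G) (G_sphere : has_genus R 0).
Local Notation f := (face_perm R).

Let cut_const (S : {set G}) (t : G -> bool) x y : #|S| < 3 ->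
  (forall u v, adj u v -> u \notin S -> v \notin S -> t u = t v) ->
  x \notin S -> y \notin S -> t x = t y.
Proof.
move=> S3 t_adj xS yS; have [_ /(_ S S3 x y xS yS)/connectP[p + ->]] := G_3conn.
elim: p x {xS} => //= z p IH x /andP[/and3P[xz xS zS] /IH <-].
exact: t_adj.
Qed.

Lemma k_connected_connected : connected G.
Proof. by move=> t t_adj x y; apply: (@cut_const set0); rewrite ?cards0 ?inE //; auto. Qed.

Let G_gt1 : 1 < #|G|.
Proof. by have [G_gt3 _] := G_3conn; apply: ltn_trans G_gt3. Qed.

(** Two vertices can be chosen that cover the edges of [d] and [d'] and leave a
    vertex on either side of the cut; the degrees are used when the two edges share
    a vertex. *)
Let no_small_cut (t : G -> bool) d d' : t (dtail d) <> t (dhead d) ->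
  t (dtail d') = t (dtail d) ->
  (forall b, t (dtail b) <> t (dhead b) ->
     [\/ b = d, b = drev d, b = d' | b = drev d']) -> False.
Proof.
have same_tail a a' : t (dtail a) <> t (dhead a) -> dtail a' = dtail a ->
    (forall b, t (dtail b) <> t (dhead b) ->
     [\/ b = a, b = drev a, b = a' | b = drev a']) -> False.
  move=> a_cut aa' only.
  have [z az [za za']] : exists2 z, adj (dtail a) z & z != dhead a /\ z != dhead a'.
    have : 0 < #|[set y | adj (dtail a) y] :\ dhead a :\ dhead a'|.
      have := cardsD1 (dhead a) [set y | adj (dtail a) y].
      have := cardsD1 (dhead a') ([set y | adj (dtail a) y] :\ dhead a).
      rewrite (G_cubic (dtail a)); case: (_ \in _); case: (_ \in _) => /=; lia.
    by rewrite card_gt0 => /set0Pn[z]; rewrite !inE => /and3P[h1 h2 h3]; exists z.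
  have [c ca cz] := dart_of az.
  have tz : t z = t (dtail a).
    apply/eqP/negP=> /negP/eqP ne.
    have : t (dtail c) <> t (dhead c) by rewrite ca cz; apply: nesym.
    case/only=> E; move: za za' ca cz; rewrite E.
    - by move=> /eqP h _ _ /esym.
    - by move=> _ _ h; case: (dart_irrefl a).
    - by move=> _ /eqP h _ /esym.
    - by move=> _ _ h; case: (dart_irrefl a'); rewrite aa'.
  apply: a_cut; rewrite -tz; apply: (@cut_const [set dtail a]).
  - by rewrite cards1.
  - move=> u v /dart_of[b <- <-]; rewrite !inE => bt bh.
    apply/eqP/negP=> /negP/eqP/only[] E; move: bt bh; rewrite E ?dtail_rev ?dhead_rev;
    by rewrite ?aa' eqxx.
  - by rewrite inE -ca -cz; apply/eqP/nesym/dart_irrefl.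
  - by rewrite inE; apply/eqP/nesym/dart_irrefl.
move=> d_cut td' only.
have [E|ne] := eqVneq (dtail d') (dtail d); first exact: same_tail d_cut E only.
have [E|ne'] := eqVneq (dhead d') (dhead d).
  apply: (same_tail (drev d) (drev d')) => //; first by rewrite !dtail_rev; apply: nesym.
  by move=> b /only[] ->; rewrite ?drevK; [constructor 2|constructor 1|constructor 4|constructor 3].
apply: d_cut; rewrite -td'; apply: (@cut_const [set dtail d; dhead d']).
- by rewrite cards2; case: (_ != _).
- move=> u v /dart_of[b <- <-]; rewrite !inE !negb_or => /andP[b1 b2] /andP[b3 b4].
  apply/eqP/negP=> /negP/eqP/only[] E; move: b1 b2 b3 b4;
  by rewrite E ?dtail_rev ?dhead_rev ?eqxx.
- by rewrite !inE negb_or ne; apply/eqP/dart_irrefl.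
- by rewrite !inE negb_or [dhead d == dhead d']eq_sym ne' andbT; apply/eqP/nesym/dart_irrefl.
Qed.

(** This is [jordan] for the dual map, whose rotation is the face permutation: the
    sets of faces become sets of vertices. *)
Let dual_jordan (c : dart G -> bool) : (forall d, c (drev d) = c d) ->
  (forall d, ~~ odd #|[set d' in porbit f d | c d']|) ->
  exists t : G -> bool, forall d, c d = t (dtail d) (+) t (dhead d).
Proof.
move=> ce c_even.
have e_inv d : drev_perm G (drev_perm G d) = d by rewrite !drev_permE drevK.
have e_fix d : drev_perm G d <> d by rewrite drev_permE; apply: drev_neq.
have efE : (drev_perm G * f)%g = R.
  by apply/permP=> d; rewrite permM drev_permE rot_face.
have [|||s [s_rot s_c]] := @jordan _ (drev_perm G) f e_inv e_fix _ _ c _ c_even.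
- move=> t te tf; apply: (connected_darts (R := R) k_connected_connected) => d.
    by rewrite -[in LHS]drev_permE te.
  by rewrite rot_face tf -drev_permE te.
- rewrite efE card_porbits_rot => [|x]; last exact: connected_dart k_connected_connected _.
  by rewrite card_porbits_drev addnC; move: G_sphere; rewrite /has_genus addn0.
- by move=> d; rewrite drev_permE.
exists (fun x => [exists d, (dtail d == x) && s d]) => d.
have tE b : [exists d, (dtail d == dtail b) && s d] = s b.
  apply/existsP/idP => [[b' /andP[/eqP E sb']]|sb]; last by exists b; rewrite eqxx.
  have sR a : s (R a) = s a by rewrite -[RHS]s_rot drev_permE rot_face.
  by rewrite -(fun_porbit sR (x := b) (y := b')) // rot_porbit E.
by rewrite tE -dtail_rev tE s_c drev_permE.
Qed.

(** An edge with the same face on both sides would be a bridge. *)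
Lemma face_rev_notin d : drev d \notin porbit f d.
Proof.
apply/negP=> dd; pose c b := (b == d) || (b == drev d).
have [||t tc] := dual_jordan (c := c).
- by move=> b; rewrite /c !(inv_eq (@drevK G)) drevK orbC.
- move=> b; have bd : (drev d \in porbit f b) = (d \in porbit f b).
    by apply/idP/idP => h; apply: porbit_trans h _; rewrite // porbit_sym.
  case h: (d \in porbit f b); rewrite ?h in bd.
    rewrite (_ : [set _ in _ | _] = [set d; drev d]) ?cards2.
      by rewrite eq_sym; case: eqP => // /drev_neq.
    by apply/setP=> a; rewrite !inE /c; case: eqP => [->|_]; rewrite ?h //=;
      case: eqP => [->|_]; rewrite ?bd ?andbF.
  rewrite (_ : [set _ in _ | _] = set0) ?cards0 //.
  by apply/setP=> a; rewrite !inE /c; case: eqP => [->|_]; rewrite ?h //=;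
      case: eqP => [->|_]; rewrite ?bd ?andbF.
apply: (no_small_cut (t := t) (d := d) (d' := d)) => //.
  by have := tc d; rewrite /c eqxx; case: (t _); case: (t _).
move=> b bt; have : c b by rewrite tc; case: (t _) bt; case: (t _).
by case/orP=> /eqP ->; [constructor 1 | constructor 2].
Qed.

(** Two edges between the same two faces would form an edge cut. *)
Lemma face_pair_unique d d' : d' \in porbit f d -> drev d' \in porbit f (drev d) ->
  d' = d.
Proof.
move=> dd' rdd'; apply/eqP/negP=> /negP ne.
pose c (a a' b : dart G) := [|| b == a, b == a', b == drev a | b == drev a'].
have c_rev a a' b : c a a' (drev b) = c a a' b.
  by rewrite /c !(inv_eq (@drevK G)) !drevK !orbA orbC !orbA [(b == a) || _]orbC;
    do !case: (_ == _).
have c_swap a a' b : c (drev a) (drev a') b = c a a' b.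
  by rewrite /c !drevK; do !case: (_ == _).
have half a a' b : a' \in porbit f a -> drev a' \in porbit f (drev a) -> a' != a ->
    a \in porbit f b -> ~~ odd #|[set x in porbit f b | c a a' x]|.
  move=> aa' raa' ne_a; rewrite -eq_porbit_mem => /eqP <-.
  rewrite (_ : [set _ in _ | _] = [set a; a']) ?cards2 1?eq_sym ?ne_a //.
  apply/setP=> x; rewrite !inE /c; apply/andP/orP=> [[xa]|].
    case/or4P=> xE; first by left.
    - by right.
    - by case/negP: (face_rev_notin a); rewrite -(eqP xE).
    case/negP: (face_rev_notin a); rewrite (eqP xE) in xa.
    by apply: porbit_trans xa _; rewrite porbit_sym.
  by case=> /eqP ->; rewrite ?porbit_id ?aa' eqxx ?orbT.
have [|b|t tc] := dual_jordan (c := c d d').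
- exact: c_rev.
- case db: (d \in porbit f b); first exact: half.
  case rdb: (drev d \in porbit f b).
    rewrite (_ : [set _ in _ | _] = [set x in porbit f b | c (drev d) (drev d') x]).
      by apply: half; rewrite ?drevK // (can_eq (@drevK G)).
    by apply/setP=> x; rewrite !inE c_swap.
  rewrite (_ : [set _ in _ | _] = set0) ?cards0 //.
  apply/setP=> x; rewrite !inE; apply/negbTE/negP=> /andP[xb].
  case/or4P=> /eqP xE; rewrite xE in xb.
  - by rewrite db in xb.
  - by move: db; rewrite (porbit_trans xb) // porbit_sym.
  - by rewrite rdb in xb.
  - by move: rdb; rewrite (porbit_trans xb) // porbit_sym.
have cP b : t (dtail b) <> t (dhead b) -> c d d' b.
  by rewrite tc; case: (t _); case: (t _).
have cN b : c d d' b -> t (dtail b) <> t (dhead b).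
  by rewrite tc; case: (t _); case: (t _).
have d_cut : t (dtail d) <> t (dhead d) by apply: cN; rewrite /c eqxx.
have d'_cut : t (dtail d') <> t (dhead d') by apply: cN; rewrite /c eqxx orbT.
case: (eqVneq (t (dtail d')) (t (dtail d))) => [E|neq].
  apply: (no_small_cut d_cut E) => b /cP/or4P[] /eqP ->;
  by [constructor 1|constructor 3|constructor 2|constructor 4].
apply: (no_small_cut (d' := drev d') d_cut).
  rewrite dtail_rev; move: neq d'_cut.
  by case: (t (dtail d')); case: (t (dhead d')); case: (t (dtail d)).
move=> b /cP/or4P[] /eqP ->; rewrite ?drevK;
by [constructor 1|constructor 4|constructor 2|constructor 3].
Qed.

Let face_vertex : finType := {A : {set dart G} | A \in porbits f}.
Let face_adj (A B : face_vertex) := [exists d, (d \in val A) && (drev d \in val B)].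

Let face_adj_sym : symmetric face_adj.
Proof.
suff sub A B : face_adj A B -> face_adj B A by move=> A B; apply/idP/idP; apply: sub.
by case/existsP=> d /andP[dA dB]; apply/existsP; exists (drev d); rewrite drevK dA dB.
Qed.

Let face_adj_irrefl : irreflexive face_adj.
Proof.
move=> [A A_face]; apply/negbTE/existsP=> -[d /= /andP[dA rdA]].
move: A_face rdA dA => /imsetP[b _ ->]; rewrite -eq_porbit_mem => /eqP E.
by rewrite -E porbit_sym (negPf (face_rev_notin d)).
Qed.

Definition dual_graph : sgraph := SGraph face_adj_sym face_adj_irrefl.

Definition face_of d : dual_graph := exist _ (porbit f d) (mem_porbits f d).

Let face_of_adj d : adj (face_of d) (face_of (drev d)).
Proof. by apply/existsP; exists d; rewrite !porbit_id. Qed.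

Definition dual_dart d : dart dual_graph :=
  exist (fun p : dual_graph * dual_graph => adj p.1 p.2)
    (face_of d, face_of (drev d)) (face_of_adj d).

Lemma face_of_eq d d' : (face_of d == face_of d') = (d' \in porbit f d).
Proof. by rewrite -(inj_eq val_inj) /= eq_porbit_mem porbit_sym. Qed.

Lemma face_of_surj (A : dual_graph) d : d \in val A -> face_of d = A.
Proof.
case: A => A A_face /= dA; apply: val_inj => /=.
by move: A_face dA => /imsetP[b _ ->]; rewrite -eq_porbit_mem => /eqP.
Qed.

Lemma dual_dart_rev d : dual_dart (drev d) = drev (dual_dart d).
Proof. by apply: dart_inj; rewrite ?dhead_rev //= /dhead /= drevK. Qed.

Lemma dual_dart_bij : bijective dual_dart.
Proof.
have inj : injective dual_dart.
  move=> d d' E; apply: face_pair_unique; rewrite -face_of_eq; apply/eqP.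
    exact: (congr1 (@dtail _) (esym E)).
  exact: (congr1 (@dhead _) (esym E)).
have surj b : exists d, dual_dart d == b.
  have /existsP[d /andP[d1 d2]] := dart_adj b; exists d; apply/eqP.
  by apply: dart_inj; apply: face_of_surj.
exists (fun b => xchoose (surj b)) => [d|b]; last exact: eqP (xchooseP (surj b)).
exact: inj (eqP (xchooseP (surj (dual_dart d)))).
Qed.

Lemma dual_triangulation : exists Q : rotation dual_graph,
  [/\ triangular Q, connected dual_graph, #|dart dual_graph| + 12 = #|dual_graph| * 6,
      3 < #|dual_graph| & is_dual G Q].
Proof.
have [k kg gk] := dual_dart_bij.
have rot_inj : injective (fun b => dual_dart (f (k b))).
  by move=> b b' /(can_inj kg)/perm_inj/(can_inj gk).
pose r := perm rot_inj.
have rE d : r (dual_dart d) = dual_dart (f d) by rewrite permE kg.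
have r_tail b : dtail (r b) = dtail b.
  rewrite -(gk b) rE; apply/eqP; rewrite eq_sym face_of_eq; exact: porbit_stable.
have r_iter n d : iter n r (dual_dart d) = dual_dart (iter n f d).
  by elim: n => //= n ->; rewrite rE.
have r_trans b b' : dtail b = dtail b' -> b' \in porbit r b.
  rewrite -(gk b) -(gk b') => /eqP; rewrite face_of_eq => /porbit_iterP[n ->].
  by apply/porbit_iterP; exists n; rewrite r_iter.
pose Q : rotation dual_graph := Rotation r_tail r_trans.
have Q_face d : face_perm Q (dual_dart d) = dual_dart (R d).
  by rewrite face_permE -dual_dart_rev rE rot_face.
have Q_iter n d : iter n (face_perm Q) (dual_dart d) = dual_dart (iter n R d).
  by elim: n => //= n ->; rewrite Q_face.
have cardD : #|dart dual_graph| = #|dart G|.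
  exact/esym/(bij_eq_card dual_dart_bij).
have cardN : #|dual_graph| = #|faces R|.
  by rewrite card_sig; apply: eq_card => A; rewrite inE.
have cardG := degree3_card_dart R G_cubic.
have /has_genus_darts euler := G_sphere.
have [G_gt3 _] := G_3conn.
exists Q; split.
- move=> b; rewrite -(gk b) !Q_face; congr dual_dart; exact: degree3_rot.
- move=> t t_adj A B.
  have t_face d : t (face_of (f d)) = t (face_of d).
    by congr t; apply/eqP; rewrite eq_sym face_of_eq porbit_stable.
  have t_rev d : t (face_of (drev d)) = t (face_of d) by apply/esym/t_adj/face_of_adj.
  have [[d _ dA] [d' _ dB]] := (imsetP (valP A), imsetP (valP B)).
  have <- : face_of d = A by apply: face_of_surj; rewrite dA porbit_id.
  have <- : face_of d' = B by apply: face_of_surj; rewrite dB porbit_id.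
  apply: (connected_darts (R := R) (t := fun d => t (face_of d)) k_connected_connected) => // a.
  by rewrite rot_face t_face.
- by rewrite cardD cardN; move: euler cardG; lia.
- by rewrite cardN; move: euler cardG G_gt3; lia.
pose h (x : G) : {set dart dual_graph} := dual_dart @: [set d | dtail d == x].
have hP d x : (dual_dart d \in h x) = (dtail d == x).
  by rewrite mem_imset ?inE //; apply: can_inj kg.
have h_porbit d : porbit (face_perm Q) (dual_dart d) = h (dtail d).
  apply/setP=> b; rewrite -(gk b) hP; apply/porbit_iterP/eqP => [[n]|/esym/(rot_iter R)[n E]].
    rewrite Q_iter => /(can_inj kg) ->; elim: n => //= n <-; exact: rot_tail.
  by exists n; rewrite Q_iter -E.
exists h; split.
- move=> x y E; have [d dx] := degree3_dart G_cubic x.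
  have : dual_dart d \in h y by rewrite -E hP dx.
  by rewrite hP dx => /eqP.
- apply/setP=> A; apply/imsetP/imsetP => [[x _ ->]|[b _ ->]].
    by have [d dx] := degree3_dart G_cubic x; exists (dual_dart d); rewrite // h_porbit dx.
  by exists (dtail (k b)); rewrite // -h_porbit gk.
move=> x y; case xy: (adj x y).
  have [d dx dy] := dart_of xy.
  rewrite (_ : [set _ in _ | _] = [set dual_dart d]) ?cards1 //.
  apply/setP=> b; rewrite !inE -(gk b) -dual_dart_rev !hP (can_eq kg).
  apply/andP/eqP => [[/eqP t /eqP hd]|->]; last by rewrite dtail_rev dx dy.
  by apply: dart_inj; rewrite ?dx ?dy.
apply: eq_card0 => b; rewrite !inE -(gk b) -dual_dart_rev !hP.
apply/negP=> /andP[/eqP t /eqP hd]; move/negP: xy; apply.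
by rewrite -t -hd dart_adj.
Qed.

End Dual.

(** * Rotations from reversed faces *)

Lemma flip_rotation (H N : sgraph) (R : rotation N) (g : dart N -> dart H)
    (s : dart N -> bool) : triangular R -> dual_darts R g -> face_invariant R s ->
  exists Q : rotation H, forall b, Q (g b) = g (flip R s b).
Proof.
move=> f3 gP sf; have [k kg gk] := dd_bij gP.
have rot_inj : injective (fun x => g (flip R s (k x))).
  by move=> x y /(can_inj kg)/(flip_inj sf)/(can_inj gk).
pose r := perm rot_inj.
have rE b : r (g b) = g (flip R s b) by rewrite permE kg.
have r_tail x : dtail (r x) = dtail x.
  rewrite -(gk x) rE; apply/eqP; rewrite eq_sym -(dd_tail gP) (porbit_face f3 _).1.
  by rewrite /flip !inE; case: ifP; rewrite eqxx ?orbT.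
have r_trans x x' : dtail x = dtail x' -> x' \in porbit r x.
  rewrite -(gk x) -(gk x') => /eqP; rewrite -(dd_tail gP) (porbit_face f3 _).1.
  move: (k x) (k x') => b b'; rewrite !inE => bb'.
  case sb: (s b); apply/porbit_iterP; case/orP: bb' => [/orP[]|] /eqP ->.
  - by exists 0.
  - by exists 2; rewrite /= !rE /flip sb !sf sb f3.
  - by exists 1; rewrite /= rE /flip sb.
  - by exists 0.
  - by exists 1; rewrite /= rE /flip sb.
  - by exists 2; rewrite /= !rE /flip sb !sf sb.
by exists (Rotation r_tail r_trans) => b; apply: rE.
Qed.

(** The vertices and edges of [G] stay the same, so that a smaller number of faces,
    which has the same parity, means a larger genus. *)
Lemma even_hole_embedding (G N : sgraph) (R0 : rotation G) (R : rotation N)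
    (W : {set N}) :
  (forall x : G, exists d, dtail d = x) -> has_genus R0 0 -> #|faces R0| = #|N| ->
  is_dual G R -> triangular R -> connected N -> 1 < #|N| -> has_genus R 0 ->
  even_hole W ->
  exists (g : nat) (Q : rotation G), [/\ 0 < g, has_genus Q g & strong Q].
Proof.
move=> no_iso /has_genus_darts euler faces0 R_dual f3 N_conn N_gt1 N_sphere W_hole.
have [_ [k kP]] := is_dual_darts R_dual.
have [s [sf ss [q qE q_lt]]] := even_hole_flip f3 N_conn N_gt1 N_sphere W_hole.
have [Q QE] := flip_rotation f3 kP sf.
have cardQ : #|faces Q| = #|porbits q|.
  pose T : finType := {A | A \in porbits q}.
  pose l b : T := exist (fun A => A \in porbits q) (porbit q b) (mem_porbits q b).
  rewrite (dual_face_label kP QE (l := l)).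
  - by rewrite card_sig; apply: eq_card => A; rewrite inE.
  - move=> b b'; have iterE n : iter n (flip_step R s) b = iter n q b.
      by elim: n => //= n ->; rewrite qE.
    split=> [[n ->]|].
      apply: val_inj; apply/eqP; rewrite /= eq_porbit_mem porbit_sym iterE.
      by apply/porbit_iterP; exists n.
    move/(congr1 val)/eqP; rewrite /= eq_sym eq_porbit_mem => /porbit_iterP[n ->].
    by exists n; rewrite iterE.
  - case=> A A_orb; have /imsetP[b _ E] := A_orb; exists b; exact: val_inj.
exists (#|faces R0| - #|faces Q|)./2, Q.
have lt : #|faces Q| < #|faces R0| by rewrite cardQ faces0.
have := odd_double_half (#|faces R0| - #|faces Q|).
rewrite oddB; last exact: ltnW.
rewrite (rotation_parity Q R0 no_iso) addbb add0n => double.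
split; last by apply/(dual_strong f3 kP QE).
  by rewrite half_gt0; move: double lt; lia.
by apply/has_genus_darts; move: double lt euler; lia.
Qed.

Theorem theorem5p4 (G : sgraph) (G_3connected : k_connected 3 G)
    (G_cubic : cubic G) (G_planar : planar G) :
  apollonian_dual G <->
  ~ exists (g : nat) (R : rotation G), [/\ 0 < g, has_genus R g & strong R].
Proof.
split=> [G_dual [g [R [g_gt0 Rg R_strong]]]|no_strong].
  by move: g_gt0; rewrite (apollonian_dual_genus G_dual Rg R_strong).
have [R0 R0_sphere] := G_planar.
have [R [f3 N_conn cardN N_gt3 R_dual]] :=
  dual_triangulation G_3connected G_cubic R0_sphere.
exists (dual_graph G_3connected G_cubic R0_sphere), R; split=> //.
apply: apollonian_of_no_even_hole => // W W_hole; apply: no_strong.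
apply: (even_hole_embedding _ R0_sphere _ R_dual f3 N_conn _ _ W_hole).
- exact: degree3_dart G_cubic.

- by rewrite card_sig; apply: eq_card => A; rewrite inE.
- by apply: ltn_trans N_gt3.
- exact: triangulation_genus0 f3 cardN.
Qed.
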